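(* The sequence $7^3 5^{17}$ is not planar graphical. That is, there is no planar graph on $20$ vertices having exactly $3$ vertices of degree $7$ and exactly $17$ vertices of degree $5$.
   Context: All graphs are finite, simple and undirected. A sequence of $n$ integers $\mathbf{d}=(d_1,d_2,\ldots,d_n)$ with $d_1 \geq d_2 \geq \ldots \geq d_n$ is called graphical if there exists a graph on $n$ vertices having degree sequence $\mathbf{d}$. A graphical sequence $\mathbf{d}$ is called planar graphical if there exists a planar graph (a graph that can be embedded in the plane without crossing edges) having degree sequence $\mathbf{d}$. The shorthand $a^b c^d \ldots$ denotes the sequence consisting of $b$ repetitions of $a$, followed by $d$ repetitions of $c$, and so on. *)

(* Defs.v *)
From HB Require Import structures.
From mathcomp Require Import all_boot all_order all_algebra.
From mathcomp Require Import all_classical all_reals all_analysis.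

Set Implicit Arguments.
Unset Strict Implicit.
Unset Printing Implicit Defensive.

Import Order.TTheory GRing.Theory Num.Theory.
Import numFieldNormedType.Exports.

Local Open Scope classical_set_scope.
Local Open Scope ring_scope.

Record sgraph := SGraph {
  vertex :> finType;
  adj : rel vertex;
  adj_sym : symmetric adj;
  adj_irrefl : irreflexive adj
}.

Definition degree (G : sgraph) (x : G) : nat := #|[set y : G | adj x y]%SET|.

Definition degree_sequence (G : sgraph) : seq nat :=
  sort geq [seq degree x | x <- enum G].

Definition edges (G : sgraph) : {set {set G}} :=
  [set [set p.1; p.2] | p : G * G & adj p.1 p.2]%SET.

(* Vertices are drawn as distinct points of the plane and edges as simple arcs,
   parametrised by the unit interval, that meet each other and the vertices
   only at their own end points; [arc A] is unconstrained unless A is an edge. *)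
Record plane_embedding (R : realType) (G : sgraph)
    (pos : G -> R * R) (arc : {set G} -> R -> R * R) : Prop := PlaneEmbedding {
  pos_inj : injective pos;
  arc_continuous : forall A, A \in edges G ->
    {within `[0, 1], continuous (arc A)};
  arc_inj : forall A, A \in edges G -> {in `[0, 1] &, injective (arc A)};
  arc_ends : forall A, A \in edges G ->
    [set arc A 0; arc A 1] = [set pos x | x in [set` A]];
  arc_vertex_disjoint : forall A x t, A \in edges G -> t \in `]0, 1[ ->
    arc A t != pos x;
  arc_arc_disjoint : forall A B s t, A \in edges G -> B \in edges G -> A != B ->
    s \in `]0, 1[ -> t \in `]0, 1[ -> arc A s != arc B t
}.

Definition planar (R : realType) (G : sgraph) : Prop :=
  exists pos arc, @plane_embedding R G pos arc.

Definition planar_graphical (R : realType) (d : seq nat) : Prop :=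
  exists G : sgraph, planar R G /\ degree_sequence G = d.

(* Main.v *)
Require Import Defs.
From HB Require Import structures.
From mathcomp Require Import all_boot all_order all_algebra.
From mathcomp Require Import all_classical all_reals all_analysis.
From mathcomp Require Import zify lra.

(** A graph with degree sequence 7^3 5^17 has 20 vertices and 53 edges, one edge
less than a triangulation of the sphere.  If it is drawn in the plane, then all
faces but one are triangles and the last one is a quadrangle, and every vertex is
surrounded by a single cyclic sequence of faces.  A finite search shows that no
such pattern of faces exists.

Continuous arcs are made combinatorial by rounding the drawing to a fine square
lattice: disjoint compact pieces of arcs have positive distance, so the graph is a
minor of the lattice ([planar_grid_minor]).  Faces then enter through algebra over
the field with two elements.  In the lattice every even set of edges is the boundary
of a set of unit squares, by adding up the vertical edges along each row
([closed_chain_face]).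
Merging the squares across all lattice edges that are neither in a branch set nor
represent an edge of the graph turns this into a 2-basis in the sense of MacLane
([grid_minor_two_basis]): a finite set of faces, two for each edge, whose
boundaries are even sets of edges and generate all of them.

Counting dimensions gives the inequality V + F >= E + 2 ([euler_rank]).  Boundaries
of faces have at least three edges and every edge lies on at most two of them, so
there are exactly 35 faces, 34 triangles and one quadrangle, and every edge lies on
two different faces ([dense_faces]).  The bound E <= 3 V - 6 for the two sides of a
cut vertex shows that no such vertex exists, and since the face boundaries generate
all cycles, the faces around a vertex cannot fall into several cyclic sequences
([link_connected]).

The search starts at the quadrangle and repeatedly chooses an edge with exactly one
known face; the other face at this edge is a triangle whose third vertex is either
already known or new, of degree 5 or 7 ([children_sound]).  Every branch ends in a
vertex whose surrounding faces contradict its degree, or in a closed pattern with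
fewer than 20 vertices ([all_refuted_true], [refuted_sound]). *)

Set Implicit Arguments.
Unset Strict Implicit.
Unset Printing Implicit Defensive.

(** * Arcs in the plane and their distances *)

Section Rounding.
Import Order.TTheory GRing.Theory Num.Theory.
Import numFieldNormedType.Exports.
Local Open Scope classical_set_scope.
Local Open Scope ring_scope.

(** Arcs are only continuous within the unit interval; composing with this retraction
makes them continuous on the whole line without changing their image. *)
Definition clamp (R : realType) (t : R) : R := Num.max 0 (Num.min 1 t).

Lemma clamp01 (R : realType) (t : R) : 0 <= clamp t <= 1.
Proof. by rewrite /clamp le_max lexx /= ge_max ler01 ge_min lexx. Qed.

Lemma clamp_id (R : realType) (t : R) : 0 <= t <= 1 -> clamp t = t.
Proof. by move=> /andP[? ?]; rewrite /clamp min_r // max_r. Qed.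

Lemma clamp_continuous (R : realType) : continuous (@clamp R).
Proof.
move=> t; apply: continuous_max; first exact: cst_continuous.
by apply: continuous_min; [exact: cst_continuous|exact: cvg_id].
Qed.

Lemma continuous_clamp (R : realType) (T : topologicalType) (f : R -> T) :
  {within `[0, 1], continuous f} -> continuous (f \o @clamp R).
Proof.
move=> /subspace_continuousP cf t.
have h : `[0, 1]%classic (clamp t) by rewrite /= in_itv /= clamp01.
move=> U /(cf _ h); rewrite /within /= => hU.
have hc : nbhs t [set s | `[0, 1]%classic (clamp s) -> U (f (clamp s))].
  exact: (@clamp_continuous R t _ hU).
suff : nbhs t [set s | U (f (clamp s))] by [].
by apply: filterS hc => s /=; apply; rewrite in_itv /= clamp01.
Qed.

Definition l1_dist (R : realType) (p q : R * R) : R :=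
  `|p.1 - q.1| + `|p.2 - q.2|.

(** The distance is a continuous function on a compact rectangle of parameters, so
it attains its minimum, which is positive. *)
Lemma separation (R : realType) (f g : R -> R * R) (a b c d : R) :
  continuous f -> continuous g -> a <= b -> c <= d ->
  (forall s t, a <= s <= b -> c <= t <= d -> f s <> g t) ->
  exists2 e : R, 0 < e &
    forall s t, a <= s <= b -> c <= t <= d -> e <= l1_dist (f s) (g t).
Proof.
move=> cf cg ab cd fg.
pose h (p : R * R) := l1_dist (f p.1) (g p.2).
have ch : continuous h.
  have cfst : continuous (fst : R * R -> R) by move=> ?; exact: cvg_fst.
  have csnd : continuous (snd : R * R -> R) by move=> ?; exact: cvg_snd.
  move=> p; apply: cvgD; apply: cvg_norm; apply: cvgB.
  - apply: (@continuous_comp _ _ _ (f \o fst) fst); last exact: cvg_fst.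
    by apply: (@continuous_comp _ _ _ fst f); [exact: cfst|exact: cf].
  - apply: (@continuous_comp _ _ _ (g \o snd) fst); last exact: cvg_fst.
    by apply: (@continuous_comp _ _ _ snd g); [exact: csnd|exact: cg].
  - apply: (@continuous_comp _ _ _ (f \o fst) snd); last exact: cvg_snd.
    by apply: (@continuous_comp _ _ _ fst f); [exact: cfst|exact: cf].
  - apply: (@continuous_comp _ _ _ (g \o snd) snd); last exact: cvg_snd.
    by apply: (@continuous_comp _ _ _ snd g); [exact: csnd|exact: cg].
have K0 : (`[a, b]%classic `*` `[c, d]%classic : set (R * R)) !=set0.
  by exists (a, c); rewrite /= !in_itv /= !lexx ab cd.
have cK : compact (`[a, b]%classic `*` `[c, d]%classic : set (R * R)).
  by apply: compact_setX; exact: segment_compact.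
have [m mK minh] := compact_EVT_min K0 cK (continuous_subspaceT ch).
exists (h m).
  move: mK; rewrite inE /= !in_itv /= => -[m1 m2].
  have := fg _ _ m1 m2; rewrite /h /l1_dist.
  case: (f m.1) (g m.2) => x y [x' y'] /= ne.
  rewrite lt_neqAle addr_ge0 // andbT eq_sym paddr_eq0 //.
  apply/negP => /andP[]; rewrite !normr_eq0 !subr_eq0 => /eqP e1 /eqP e2.
  by apply: ne; rewrite e1 e2.
move=> s t st tt; apply: (minh (s, t)).
by rewrite inE /= !in_itv.
Qed.

(** The two sets where the property holds and fails would separate the line, which
is connected. *)
Lemma locally_constant (R : realType) (P : R -> Prop) :
  (forall t, \forall u \near t, P t <-> P u) -> forall a b, P a -> P b.
Proof.
move=> lP a b Pa; apply: contrapT => nPb.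
have : connected ([set: R]) by apply/connected_intervalP.
move=> /connectedP /(_ (fun i : bool => [set t | if i then P t else ~ P t])).
apply; split.
- by case; [exists a|exists b].
- by apply/seteqP; split=> t //= _; case: (pselect (P t)); [right|left].
- split; apply/seteqP; split=> // t [].
    by move=> /(_ _ (lP t)) [u [/= nPu PtPu]] /= Pt; exact/nPu/PtPu.
  by move=> /= nPt /(_ _ (lP t)) [u [/= Pu PtPu]]; exact/nPt/PtPu.
Qed.

(** * Walks in the square lattice *)

Definition adj4 (p q : nat * nat) : bool :=
  (p.1 == q.1) && ((p.2 == q.2.+1) || (q.2 == p.2.+1)) ||
  (p.2 == q.2) && ((p.1 == q.1.+1) || (q.1 == p.1.+1)).

Lemma adj4_sym : symmetric adj4.
Proof.
move=> [a b] [c d]; rewrite /adj4 /=; apply/idP/idP; lia.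
Qed.

(** The whole walk, end points included, stays in [S]. *)
Definition reach (S : nat * nat -> Prop) (p q : nat * nat) : Prop :=
  exists2 w, path adj4 p w && (last p w == q) & forall c, c \in p :: w -> S c.

Lemma reach_refl (S : nat * nat -> Prop) p : S p -> reach S p p.
Proof. by move=> Sp; exists [::] => [|c]; rewrite /= ?eqxx // inE => /eqP->. Qed.

Lemma reach_step (S : nat * nat -> Prop) p q :
  S p -> S q -> adj4 p q -> reach S p q.
Proof.
move=> Sp Sq pq; exists [:: q] => [|c]; first by rewrite /= pq eqxx.
by rewrite !inE => /orP[] /eqP->.
Qed.

Lemma reach_trans (S : nat * nat -> Prop) p q r :
  reach S p q -> reach S q r -> reach S p r.
Proof.
move=> [w /andP[pw /eqP lw] Sw] [x /andP[px /eqP lx] Sx]; exists (w ++ x).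
  by rewrite cat_path last_cat lw pw px lx eqxx.
move=> c; rewrite inE mem_cat orbA => /orP[cw|cx]; first by apply: Sw; rewrite inE.
by apply: Sx; rewrite inE cx orbT.
Qed.

Lemma reach_sym (S : nat * nat -> Prop) p q : reach S p q -> reach S q p.
Proof.
move=> [w /andP[pw /eqP lw] Sw]; exists (rev (belast p w)).
  rewrite -lw rev_path (@eq_path _ _ adj4); last by move=> ? ? /=; rewrite adj4_sym.
  rewrite pw /=; case: w {pw lw Sw} => [|x w] //=.
  by rewrite rev_cons last_rcons.
move=> c; rewrite -lw -rev_rcons mem_rev -lastI; exact: Sw.
Qed.

Lemma reach_sub (S T : nat * nat -> Prop) p q :
  (forall c, S c -> T c) -> reach S p q -> reach T p q.
Proof. by move=> ST [w ww Sw]; exists w => // c /Sw /ST. Qed.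

Definition nearby (R : realType) (d : R) (c : nat * nat) (p : R * R) : Prop :=
  `|c.1%:R * d - p.1| <= 2 * d /\ `|c.2%:R * d - p.2| <= 2 * d.

Definition cell (R : realType) (d : R) (p : R * R) : nat * nat :=
  (Num.truncn (p.1 / d), Num.truncn (p.2 / d)).

Lemma truncn_near (R : realType) (d x : R) : 0 < d -> 0 <= x ->
  `|(Num.truncn (x / d))%:R * d - x| <= d.
Proof.
move=> d0 x0; have /truncn_itv /andP[h1 h2] : 0 <= x / d by rewrite divr_ge0 // ltW.
rewrite ler_pdivlMr // in h1; rewrite ltr_pdivrMr // -natr1 mulrDl mul1r in h2.
by rewrite ler_norml; apply/andP; split; lra.
Qed.

Lemma truncn_close (R : realType) (d x y : R) : 0 < d -> 0 <= x -> 0 <= y ->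
  `|x - y| < d ->
  (Num.truncn (x / d) <= (Num.truncn (y / d)).+1)%N.
Proof.
move=> d0 x0 y0; rewrite ltr_norml => /andP[_ xy].
have /truncn_itv /andP[h1 _] : 0 <= x / d by rewrite divr_ge0 // ltW.
have /truncn_itv /andP[_ h2] : 0 <= y / d by rewrite divr_ge0 // ltW.
rewrite -ltnS -(ltr_nat R) (le_lt_trans h1) // -natr1 -ltrBlDr.
apply: le_lt_trans h2; rewrite lerBlDr -[1](divff (lt0r_neq0 d0)) -mulrDl.
by rewrite ler_pM2r ?invr_gt0 //; lra.
Qed.

Lemma cell_nearby (R : realType) (d : R) p : 0 < d -> 0 <= p.1 -> 0 <= p.2 ->
  nearby d (cell d p) p.
Proof.
by move=> d0 p1 p2; split; apply: (le_trans (truncn_near d0 _)) => //; lra.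
Qed.

(** The two cells differ by at most one in each coordinate; an intermediate cell
turns a diagonal step into two lattice steps.  The factor two in [nearby] leaves room
for this intermediate cell. *)
Lemma reach_close (R : realType) (d : R) (S : nat * nat -> Prop) p q :
  0 < d -> 0 <= p.1 -> 0 <= p.2 -> 0 <= q.1 -> 0 <= q.2 ->
  `|p.1 - q.1| < d -> `|p.2 - q.2| < d -> (forall c, nearby d c p -> S c) ->
  reach S (cell d p) (cell d q).
Proof.
move=> d0 p1 p2 q1 q2 pq1 pq2 hS.
have step S' (m n m' n' : nat) : (m = m' /\ (n <= n'.+1)%N /\ (n' <= n.+1)%N) \/
    (n = n' /\ (m <= m'.+1)%N /\ (m' <= m.+1)%N) ->
    S' (m, n) -> S' (m', n') -> reach S' (m, n) (m', n').
  move=> h Sm Sm'.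
  case: (altP ((m, n) =P (m', n'))) => [<-|ne]; first exact: reach_refl.
  apply: reach_step => //; rewrite /adj4 /=.
  by move: ne; rewrite xpair_eqE; lia.
have tr x y : 0 <= x -> 0 <= y -> `|x - y| < d ->
  `|(Num.truncn (y / d))%:R * d - x| <= 2 * d.
  move=> x0 y0; have := truncn_near d0 y0; rewrite !ler_norml ltr_norml.
  by move=> /andP[? ?] /andP[? ?]; apply/andP; split; lra.
have tc := truncn_close d0.
apply: (@reach_trans _ _ (Num.truncn (q.1 / d), Num.truncn (p.2 / d))).
  apply: step; first by right; rewrite !tc // distrC.
    by apply: hS; exact: cell_nearby.
  by apply: hS; split; apply: tr => //; rewrite subrr normr0.
apply: step; first by left; rewrite !tc // distrC.
  by apply: hS; split; apply: tr => //; rewrite subrr normr0.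
by apply: hS; split; exact: tr.
Qed.

(** By [reach_close], whether the cell of [f t] can be reached from the first one does
not change for small variations of [t], so [locally_constant] applies. *)
Lemma reach_path (R : realType) (d : R) (f : R -> R * R) (a b : R) :
  0 < d -> continuous f -> (forall t, 0 <= (f t).1 /\ 0 <= (f t).2) -> a <= b ->
  reach (fun c => exists2 t, a <= t <= b & nearby d c (f t))
    (cell d (f a)) (cell d (f b)).
Proof.
move=> d0 cf f0 ab; set S := fun c => _.
pose k (t : R) : R := Num.max a (Num.min b t).
have ck : continuous k.
  move=> t; apply: continuous_max; first exact: cst_continuous.
  by apply: continuous_min; [exact: cst_continuous|exact: cvg_id].
have kab t : a <= k t <= b by rewrite /k le_max lexx /= ge_max ab ge_min lexx.
have ka : k a = a by rewrite /k min_r // max_l.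
have kb : k b = b by rewrite /k min_l // max_r.
have cg : continuous (f \o k) by move=> t; apply: continuous_comp; [exact: ck|exact: cf].
rewrite -{1}ka -kb.
pose P t := reach S (cell d (f (k a))) (cell d (f (k t))).
apply: (@locally_constant _ P) => [t|]; last first.
  apply: reach_refl; exists (k a); first exact: kab.
  by apply: cell_nearby => //; case: (f0 (k a)).
have c1 : continuous (fst \o (f \o k)).
  by move=> u; apply: continuous_comp; [exact: cg|exact: cvg_fst].
have c2 : continuous (snd \o (f \o k)).
  by move=> u; apply: continuous_comp; [exact: cg|exact: cvg_snd].
have n1 : \forall u \near t, `|(f (k t)).1 - (f (k u)).1| < d.
  by have /cvgrPdist_lt /(_ _ d0) := c1 t.
have n2 : \forall u \near t, `|(f (k t)).2 - (f (k u)).2| < d.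
  by have /cvgrPdist_lt /(_ _ d0) := c2 t.
apply: filterS2 n1 n2 => u u1 u2.
have r : reach S (cell d (f (k t))) (cell d (f (k u))).
  have [? ?] := f0 (k t); have [? ?] := f0 (k u).
  by apply: reach_close => // c nc; exists (k t).
by split=> h; apply: reach_trans h _ => //; apply: reach_sym.
Qed.

Lemma reach_in (S : nat * nat -> Prop) p q : reach S p q -> S p /\ S q.
Proof.
move=> [w /andP[_ /eqP <-] Sw]; split; first by apply: Sw; rewrite inE eqxx.
by apply: Sw; exact: mem_last.
Qed.

(** Every cell of the walk can itself be reached inside [S], so the set of reachable
cells is connected. *)
Lemma reach_self (S : nat * nat -> Prop) p q :
  reach S p q -> reach (reach S p) p q.
Proof.
move=> [w /andP[pw lw] Sw]; exists w; first by rewrite pw.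
move=> c; rewrite inE => /orP[/eqP->|cw]; first by apply: reach_refl; apply: Sw; rewrite inE eqxx.
case/splitPr: cw pw Sw {lw} => w1 w2; rewrite cat_path /= => /and3P[p1 p2 _] Sw.
exists (rcons w1 c); first by rewrite rcons_path p1 p2 last_rcons eqxx.
move=> d dw; apply: Sw; move: dw; rewrite inE mem_rcons !inE mem_cat inE.
by case/or3P=> ->; rewrite ?orbT.
Qed.

(** A walk that ends in [T] has a first cell in [T]; the conclusion is about the part
before it. *)
Lemma reach_hit (S T : nat * nat -> Prop) p q :
  reach S p q -> ~ T p -> T q ->
  exists c c', [/\ reach (fun d => S d /\ ~ T d) p c, adj4 c c' & T c'].
Proof.
move=> [w]; elim: w p => [|r w IH] p /= => [/eqP -> _ //|].
move=> /andP[/andP[pr pw] lw] Sw nTp Tq.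
have Sp : S p by apply: Sw; rewrite inE eqxx.
case: (pselect (T r)) => [Tr|nTr].
  by exists p, r; split=> //; apply: reach_refl.
have [||c [c' [h1 h2 h3]]] := IH r _ _ nTr Tq; first by rewrite pw.
  by move=> d dw; apply: Sw; rewrite inE dw orbT.
exists c, c'; split=> //; apply: reach_trans h1; apply: reach_step => //.
by split=> //; apply: Sw; rewrite !inE eqxx orbT.
Qed.

(** * A plane graph is a minor of the square lattice *)

Definition offset (R : realType) (k : R) (p : R * R) : R * R := (p.1 + k, p.2 + k).

Lemma offset_continuous (R : realType) (k : R) (f : R -> R * R) :
  continuous f -> continuous (offset k \o f).
Proof.
move=> cf t; apply: (@continuous_comp _ _ _ f (offset k)); first exact: cf.
have c1 : (fun p : R * R => p.1 + k) @ f t --> (f t).1 + k.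
  by apply: cvgD; [exact: cvg_fst|exact: cvg_cst].
have c2 : (fun p : R * R => p.2 + k) @ f t --> (f t).2 + k.
  by apply: cvgD; [exact: cvg_snd|exact: cvg_cst].
exact: (cvg_pair c1 c2).
Qed.

Lemma nearby_l1_dist (R : realType) (d : R) c p q :
  nearby d c p -> nearby d c q -> l1_dist p q <= 8 * d.
Proof.
move=> [p1 p2] [q1 q2]; rewrite /l1_dist.
have tri (x y z : R) : `|z - x| <= 2 * d -> `|z - y| <= 2 * d -> `|x - y| <= 4 * d.
  by rewrite !ler_norml => /andP[? ?] /andP[? ?]; apply/andP; split; lra.
by have := tri _ _ _ p1 q1; have := tri _ _ _ p2 q2; lra.
Qed.

(** The third of the unit interval next to the end point [i]. *)
Definition in_end_third (R : realType) (i : bool) (t : R) : bool :=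
  if i then 2 / 3 <= t <= 1 else 0 <= t <= 1 / 3.

(** The set [C v] is the branch set of the vertex [v], connected around its base cell
[b v].  Only cells with positive coordinates are used, so that all four neighbours and
all four unit squares around a cell of a branch set exist in the quadrant. *)
Record grid_minor (G : sgraph) (C : G -> nat * nat -> Prop) (b : G -> nat * nat)
  (N : nat) : Prop := GridMinor {
  gm_bound : forall v c, C v c -> (0 < c.1 < N)%N /\ (0 < c.2 < N)%N;
  gm_disj : forall u v c, C u c -> C v c -> u = v;
  gm_conn : forall v c, C v c -> reach (C v) (b v) c;
  gm_adj : forall x y, adj x y -> exists p q, [/\ C x p, C y q & adj4 p q] }.

Section Planar.
Variables (R : realType) (G : sgraph) (pos : G -> R * R) (arc : {set G} -> R -> R * R).
Hypothesis emb : plane_embedding pos arc.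
Local Notation E := (edges G).

Lemma edgesP (A : {set G}) :
  reflect (exists x y, adj x y /\ A = [set x; y]%SET) (A \in E).
Proof.
apply: (iffP imsetP) => [[[x y] xy ->]|[x [y [xy ->]]]].
  by exists x, y; split=> //; move: xy; rewrite inE.
by exists (x, y); rewrite ?inE.
Qed.

(** The definition of an embedding gives the end points of an arc only as a set;
injectivity of the arc makes them two different vertices. *)
Lemma arc_tags A : A \in E ->
  exists s t, [/\ A = [set s; t]%SET, s != t, arc A 0 = pos s & arc A 1 = pos t].
Proof.
move=> AE; have /edgesP[x [y [xy Axy]]] := AE.
have e := arc_ends emb AE.
have [s sA es] : [set pos x | x in [set` A]] (arc A 0) by rewrite -e; left.
have [t tA et] : [set pos x | x in [set` A]] (arc A 1) by rewrite -e; right.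
have st : s != t.
  apply/eqP => st; move: et; rewrite -st es => /(arc_inj emb AE).
  rewrite !in_itv /= !lexx ler01 => /(_ isT isT) /eqP.
  by rewrite eq_sym oner_eq0.
exists s, t; split=> //; move: sA tA st; rewrite /= Axy !inE.
case/orP=> /eqP-> /orP[] /eqP->; rewrite ?eqxx //.
by rewrite finset.setUC.
Qed.

Definition drawn (k : R) (A : {set G}) : R -> R * R :=
  offset k \o (arc A \o @clamp R).

Lemma drawn_continuous k A : A \in E -> continuous (drawn k A).
Proof.
by move=> AE; apply: offset_continuous; apply: continuous_clamp; exact: (arc_continuous emb).
Qed.

Lemma offset_inj (k : R) : injective (offset k).
Proof. by move=> [a b] [c d] [] /addIr-> /addIr->. Qed.

Lemma endpoint_cases (t : R) : 0 <= t <= 1 -> [\/ t \in `]0, 1[, t = 0 | t = 1].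
Proof.
move=> /andP[t0 t1]; case: (eqVneq t 0) => [|n0]; first by constructor 2.
case: (eqVneq t 1) => [|n1]; first by constructor 3.
by constructor 1; rewrite in_itv /= !lt_neqAle t0 t1 n1 eq_sym n0.
Qed.

(** A point in the middle third is interior to its arc, so it lies on no other arc. *)
Lemma middle_disj k A B s t : A \in E -> B \in E -> A != B ->
  1 / 3 <= s <= 2 / 3 -> 0 <= t <= 1 -> drawn k A s <> drawn k B t.
Proof.
move=> AE BE AB sm t01 /offset_inj /=.
rewrite !clamp_id //; last by lra.
have si : s \in `]0, 1[ by rewrite in_itv /=; lra.
have [x [y [_ _ e0 e1]]] := arc_tags BE.
case: (endpoint_cases t01) => [ti|->|->].
- by apply/eqP; exact: (arc_arc_disjoint emb).
- by rewrite e0; apply/eqP; exact: (arc_vertex_disjoint emb).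
- by rewrite e1; apply/eqP; exact: (arc_vertex_disjoint emb).
Qed.

(** Two end thirds can only meet in a common vertex, and the thirds of one arc are
disjoint because the arc is injective. *)
Lemma third_disj k A B (i j : bool) s t : A \in E -> B \in E ->
  arc A i%:R <> arc B j%:R -> in_end_third i s -> in_end_third j t ->
  drawn k A s <> drawn k B t.
Proof.
move=> AE BE ne si tj /offset_inj /=.
have t01 : 0 <= t <= 1 by move: tj; rewrite /in_end_third; case: ifP; lra.
have s01 : 0 <= s <= 1 by move: si; rewrite /in_end_third; case: ifP; lra.
rewrite !clamp_id // => st.
have tend : t = 0 \/ t = 1 -> t = j%:R.
  by move: tj; rewrite /in_end_third; case: (j) => /=; rewrite ?mulr1n ?mulr0n => ? []; lra.
have send : s = 0 \/ s = 1 -> s = i%:R.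
  by move: si; rewrite /in_end_third; case: (i) => /=; rewrite ?mulr1n ?mulr0n => ? []; lra.
case: (eqVneq A B) => [AB|AB].
  subst B; have {}st : s = t by apply: (arc_inj emb AE) st; rewrite in_itv.
  move: ne si tj; rewrite -st /in_end_third.
  by case: (i) (j) => [] [] //= _; lra.
have posend (A' : {set G}) (i' : bool) : A' \in E -> exists x, arc A' i'%:R = pos x.
  move=> /arc_tags[x [y [_ _ e0 e1]]].
  by case: i'; [exists y; rewrite mulr1n|exists x; rewrite mulr0n].
have vd (A' : {set G}) (u : R) x : A' \in E -> u \in `]0, 1[ -> arc A' u <> pos x.
  by move=> *; apply/eqP; exact: (arc_vertex_disjoint emb).
case: (endpoint_cases s01) (endpoint_cases t01) => [si'|s0|s1] [ti|t0|t1].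
- by move/eqP: st; apply/negP; exact: (arc_arc_disjoint emb).
- move: st; rewrite tend; last by left.
  by have [x ->] := posend _ j BE; exact: vd.
- move: st; rewrite tend; last by right.
  by have [x ->] := posend _ j BE; exact: vd.
all: have es : s = i%:R by apply: send; first [by left|by right].
all: try (have et : t = j%:R by apply: tend; first [by left|by right]).
all: try by apply: ne; rewrite -es -et.
all: move: st; rewrite es; have [x ->] := posend _ i AE.
all: by move/esym; exact: vd.
Qed.
End Planar.

Lemma clamp_bounded (R : realType) (f : R -> R * R) : continuous f ->
  exists k : R, forall t, 0 <= t <= 1 -> `|(f t).1| + `|(f t).2| <= k.
Proof.
move=> cf; pose g t := `|(f t).1| + `|(f t).2|.
have cg : continuous g.
  move=> t; apply: cvgD; apply: cvg_norm.
    by apply: (@continuous_comp _ _ _ f fst); [exact: cf|exact: cvg_fst].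
  by apply: (@continuous_comp _ _ _ f snd); [exact: cf|exact: cvg_snd].
have [c _ cmax] := EVT_max ler01 (continuous_subspaceT cg).
by exists (g c) => t t01; apply: cmax; rewrite in_itv.
Qed.

Section Planar.
Variables (R : realType) (G : sgraph) (pos : G -> R * R) (arc : {set G} -> R -> R * R).
Hypothesis emb : plane_embedding pos arc.
Local Notation E := (edges G).
Local Notation drawn := (drawn arc).

(** The drawing is bounded, so a translation moves it into the quadrant; the margin 3
keeps every cell that is close to the drawing at positive coordinates. *)
Lemma drawn_bounds : exists k, forall A t, A \in E ->
  [/\ 3 <= (drawn k A t).1 <= k + k, 3 <= (drawn k A t).2 <= k + k & 0 <= k].
Proof.
have [k hk] : exists k : R, forall A : {set G}, A \in E ->
    forall t, 0 <= t <= 1 -> `|(arc A t).1| + `|(arc A t).2| <= k.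
  suff : \forall k \near +oo, forall A : {set G}, A \in E ->
    forall t : R, 0 <= t <= 1 -> `|(arc A t).1| + `|(arc A t).2| <= k.
    by move=> /filter_ex.
  apply: filter_forall => A; case: (boolP (A \in E)) => [AE|_]; last exact: nearW.
  have [k hk] := clamp_bounded (continuous_clamp (arc_continuous emb AE)).
  have := @nbhs_pinfty_ge R k (num_real k); apply: filterS => l kl _ t t01.
  by apply: le_trans kl; have := hk t t01; rewrite /= clamp_id.
exists (Num.max 0 k + 3) => A t AE.
have := hk A AE (clamp t) (clamp01 t).
have kk : k <= Num.max 0 k by rewrite le_max lexx orbT.
have k0 : 0 <= Num.max 0 k by rewrite le_max lexx.
set K := Num.max 0 k in kk k0 *.
rewrite /drawn /offset /=; case: (arc A (clamp t)) => x y /= h.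
have [hx hy] : `|x| <= K /\ `|y| <= K.
  by have := normr_ge0 x; have := normr_ge0 y; split; lra.
move: hx hy; rewrite !ler_norml => /andP[? ?] /andP[? ?].
by split; last lra; apply/andP; split; lra.
Qed.

(** Finitely many pairs of disjoint compact pieces of arcs occur, so one mesh width is
small for all of them.  The factor 8 is the bound of [nearby_l1_dist]. *)
Lemma mesh k : exists d : R, [/\ 0 < d, d <= 1,
  forall A B s t, A \in E -> B \in E -> A != B ->
    1 / 3 <= s <= 2 / 3 -> 0 <= t <= 1 -> 8 * d < l1_dist (drawn k A s) (drawn k B t)
  & forall A B (i j : bool) s t, A \in E -> B \in E -> arc A i%:R <> arc B j%:R ->
    in_end_third i s -> in_end_third j t -> 8 * d < l1_dist (drawn k A s) (drawn k B t)].
Proof.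
have near_sep (h : R -> R -> R) (a b c d e : R) : 0 < e ->
    (forall s t, a <= s <= b -> c <= t <= d -> e <= h s t) ->
  \forall x \near 0^'+, forall s t, a <= s <= b -> c <= t <= d -> 8 * x < h s t.
  move=> e0 he; have e9 : 0 < e / 9 by rewrite divr_gt0.
  have := nbhs_right_le e9; apply: filterS => x xe s t ss tt.
  by apply: lt_le_trans (he s t ss tt); lra.
have n1 : \forall x \near 0^'+, forall AB : {set G} * {set G},
    AB.1 \in E -> AB.2 \in E -> AB.1 != AB.2 ->
    forall s t, 1 / 3 <= s <= 2 / 3 -> 0 <= t <= 1 ->
      8 * x < l1_dist (drawn k AB.1 s) (drawn k AB.2 t).
  apply: filter_forall => -[A B] /=.
  have [AE|nA] := boolP (A \in E); last exact: nearW.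
  have [BE|nB] := boolP (B \in E); last exact: nearW.
  have [AB|nAB] := eqVneq A B; first exact: nearW.
  have [||e e0 he] := separation (drawn_continuous emb (k := k) AE)
    (drawn_continuous emb (k := k) BE) _ _ (fun s t => middle_disj emb (k := k) (s := s) (t := t) AE BE nAB).
  - by lra.
  - by lra.
  by have := near_sep _ _ _ _ _ _ e0 he; apply: filterS => x hx _ _ _.
have n2 : \forall x \near 0^'+, forall q : ({set G} * {set G}) * (bool * bool),
    q.1.1 \in E -> q.1.2 \in E -> arc q.1.1 q.2.1%:R <> arc q.1.2 q.2.2%:R ->
    forall s t, in_end_third q.2.1 s -> in_end_third q.2.2 t ->
      8 * x < l1_dist (drawn k q.1.1 s) (drawn k q.1.2 t).
  apply: filter_forall => -[[A B] [i j]] /=.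
  have [AE|nA] := boolP (A \in E); last exact: nearW.
  have [BE|nB] := boolP (B \in E); last exact: nearW.
  have [AB|nAB] := pselect (arc A i%:R = arc B j%:R); first exact: nearW.
  have itv (l : bool) : exists a b : R, a <= b /\ forall s, in_end_third l s = (a <= s <= b).
    by case: l; [exists (2 / 3), 1|exists 0, (1 / 3)]; split=> //; lra.
  have [a [b [ab ib]]] := itv i; have [c [d [cd jd]]] := itv j.
  have [|e e0 he] := separation (drawn_continuous emb (k := k) AE)
    (drawn_continuous emb (k := k) BE) ab cd.
    by move=> s t; rewrite -ib -jd; exact: (third_disj emb).
  have := near_sep _ _ _ _ _ _ e0 he; apply: filterS => x hx _ _ _ s t.
  by rewrite ib jd; exact: hx.
have n3 : \forall x \near 0^'+, (x : R) <= 1 by exact: nbhs_right_le.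
have n4 : \forall x \near 0^'+, 0 < (x : R) by exact: nbhs_right_gt.
have [x [[[h1 h2] h3] h4]] := filter_ex (filterI (filterI (filterI n1 n2) n3) n4).
exists x; split=> //.
- by move=> A B s t AE BE AB; exact: (h1 (A, B)).
- by move=> A B i j s t AE BE AB; exact: (h2 ((A, B), (i, j))).
Qed.

(** The branch set of a vertex collects the cells near the end thirds of its arcs.  The
cells near a middle third are given to the first end point of the arc, as far as they
can be reached from it before the branch set of the second end point is met; the step
into that set is the lattice edge that represents the arc.  All sets are disjoint since
their pieces of arcs are further apart than two cells near the same point can be. *)
Lemma planar_grid_minor : exists C b N, @grid_minor G C b N.
Proof.
have [k hk] := drawn_bounds; have [d [d0 dle1 sep1 sep2]] := mesh k.
pose f := drawn k.
pose M A c := exists2 t, 1 / 3 <= t <= 2 / 3 & nearby d c (f A t).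
pose Nr (v : G) c := exists A (i : bool) t, [/\ A \in E, arc A i%:R = pos v,
  in_end_third i t & nearby d c (f A t)].
pose b v := cell d (offset k (pos v)).
pose Rv v c := reach (Nr v) (b v) c.
(* the cells of the middle third that are reached before the second end point's set *)
pose X A c := reach (fun c => M A c /\ forall t, arc A 1 = pos t -> ~ Rv t c)
  (cell d (f A (1 / 3))) c.
pose C v c := Rv v c \/ exists A, [/\ A \in E, arc A 0 = pos v & X A c].
have f_ge0 A t : A \in E -> 0 <= (f A t).1 /\ 0 <= (f A t).2.
  by move=> AE; have [/andP[? _] /andP[? _] _] := hk A t AE; split; rewrite /f; lra.
have RN v c : Rv v c -> Nr v c by move=> h; have [] := reach_in h.
have XM A c : X A c -> M A c by move=> h; have [_ []] := reach_in h.
have Xn A c t : X A c -> arc A 1 = pos t -> ~ Rv t c.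
  by move=> h; have [_ [_ +]] := reach_in h; exact.
have far p q c : 8 * d < l1_dist p q -> nearby d c p -> nearby d c q -> False.
  by move=> h n1 n2; have := nearby_l1_dist n1 n2; rewrite leNgt h.
have fend A (i : bool) : f A i%:R = offset k (arc A i%:R).
  by rewrite /f /drawn /= clamp_id //; case: (i); rewrite ?mulr1n ?mulr0n; lra.
have R_third A (i : bool) v t : A \in E -> arc A i%:R = pos v -> in_end_third i t ->
    Rv v (cell d (f A t)).
  move=> AE Av it; rewrite /Rv /b -Av -fend.
  have cf := drawn_continuous emb (k := k) AE.
  have fp := fun t => f_ge0 A t AE.
  case: i it Av => /= it Av.
    apply: reach_sym; have t1 : t <= 1%:R by move: it => /andP[].
    apply: reach_sub (reach_path d0 cf fp t1) => c [u u1 nu].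
    exists A, true, u; split=> //; rewrite /in_end_third; move: it u1; rewrite mulr1n; lra.
  have t0 : 0%:R <= t by move: it => /andP[].
  apply: reach_sub (reach_path d0 cf fp t0) => c [u u1 nu].
  exists A, false, u; split=> //; rewrite /in_end_third; move: it u1; rewrite mulr0n; lra.
have R_disj u v c : Rv u c -> Rv v c -> u = v.
  move=> /RN[A [i [s [AE Au si ns]]]] /RN[B [j [t [BE Bv tj nt]]]].
  apply: contrapT => uv; apply: (far _ _ _ _ ns nt); apply: (sep2 _ _ i j) => //.
  by rewrite Au Bv => /(pos_inj emb).
have RX_disj u v A c : Rv v c -> A \in E -> arc A 0 = pos u -> X A c -> u = v.
  move=> Rc AE Au Xc; have [B [j [t [BE Bv tj nt]]]] := RN _ _ Rc.
  have [s sm ns] := XM _ _ Xc.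
  have [AB|AB] := eqVneq A B; last first.
    case: (far _ _ _ _ ns nt); apply: sep1 => //.
    by move: tj; rewrite /in_end_third; case: ifP; lra.
  subst B; case: j Bv tj => Bv tj; first by case: (Xn _ _ v Xc).
  by apply: (pos_inj emb); rewrite -Au -Bv.
have XX_disj A B c : A \in E -> B \in E -> X A c -> X B c -> A = B.
  move=> AE BE /XM[s sm ns] /XM[t tm nt]; apply/eqP; apply: contraT => AB.
  by case: (far _ _ _ _ ns nt); apply: sep1 => //; lra.
have C_disj u v c : C u c -> C v c -> u = v.
  case=> [Ru|[A [AE Au XA]]] [Rv'|[B [BE Bv XB]]].
  - exact: R_disj Ru Rv'.
  - by apply/esym; exact: RX_disj Ru BE Bv XB.
  - exact: RX_disj Rv' AE Au XA.
  - by apply: (pos_inj emb); rewrite -Au -Bv (XX_disj _ _ _ AE BE XA XB).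
exists C, b, (Num.truncn ((k + k + 2) / d)).+1; split=> //.
- move=> v c Cc.
  have [A [t [AE [n1 n2]]]] : exists A t, A \in E /\ nearby d c (f A t).
    case: Cc => [/RN[A [i [t [AE _ _ nt]]]]|[A [AE _ /XM[t _ nt]]]].
      by exists A, t.
    by exists A, t.
  have [/andP[a1 a2] /andP[a3 a4] k0] := hk A t AE.
  have bnd (m : nat) (x : R) : 3 <= x <= k + k -> `|m%:R * d - x| <= 2 * d ->
    (0 < m < (Num.truncn ((k + k + 2) / d)).+1)%N.
    move=> /andP[x3 xk]; rewrite ler_norml => /andP[h1 h2]; apply/andP; split.
      rewrite lt0n; apply/eqP => m0; move: h1; rewrite m0 mul0r; lra.
    have : 0 <= (k + k + 2) / d by apply: divr_ge0; lra.
    move=> /truncn_itv /andP[_ lt]; rewrite -(ltr_nat R); apply: le_lt_trans lt.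
    by rewrite ler_pdivlMr //; lra.
  by split; [apply: bnd n1|apply: bnd n2]; rewrite ?a1 ?a3.
- move=> v c [Rc|[A [AE Av Xc]]].
    by apply: reach_sub (reach_self Rc) => c' ?; left.
  apply: (@reach_trans _ _ (cell d (f A (1 / 3)))).
    apply: reach_sub (reach_self _) => [c' h|]; first by left; exact: h.
    by apply: (R_third A false) => //=; lra.
  by apply: reach_sub (reach_self Xc) => c' ?; right; exists A.
- move=> x y xy; pose A := [set x; y]%SET.
  have AE : A \in E by apply/edgesP; exists x, y.
  have [s [t [Ast st As At]]] := arc_tags emb AE.
  suff [p [q [Cp Cq pq]]] : exists p q, [/\ C s p, C t q & adj4 p q].
    have : x != y by apply/eqP => exy; move: xy; rewrite exy adj_irrefl.
    have : x \in A by rewrite !inE eqxx.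
    have : y \in A by rewrite !inE eqxx orbT.
    rewrite Ast !inE => /orP[]/eqP-> /orP[]/eqP->; rewrite ?eqxx // => _.
      by exists q, p; rewrite adj4_sym.
    by exists p, q.
  have h13 : 1 / 3 <= (2 / 3 : R) by lra.
  have r := reach_path d0 (drawn_continuous emb (k := k) AE) (fun t => f_ge0 A t AE) h13.
  have Rs : Rv s (cell d (f A (1 / 3))) by apply: (R_third A false) => //=; lra.
  have Rt : Rv t (cell d (f A (2 / 3))) by apply: (R_third A true) => //=; lra.
  (* the last cell before the branch set of [t] is met belongs to [X A], hence to [C s] *)
  have [|c [c' [rc cc' Rc']]] := reach_hit r _ Rt.
    by move=> Rt'; move/eqP: st; apply; exact: R_disj Rs Rt'.
  exists c, c'; split=> //; last by left.
  right; exists A; split=> //; apply: reach_sub rc => p [Mp nRp]; split=> // t' At'.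
  by have <- : t = t' by apply: (pos_inj emb); rewrite -At -At'.
Qed.
End Planar.
End Rounding.

(** * Faces of a lattice minor *)

(** The elements of the cycle space over the field with two elements; the sum is the
parity of the degree of [v] in [z]. *)
Definition even_set (G : sgraph) (z : {set {set G}}) : Prop :=
  z \subset edges G /\ forall v, \big[addb/false]_(A in z | v \in A) true = false.

Definition boundary (G : sgraph) (F : finType) (face : {set G} -> bool -> F) (f : F) :
    {set {set G}} :=
  [set A in edges G | (face A false == f) (+) (face A true == f)]%SET.

(** The two sides of an edge [A] lie in the faces [face A false] and [face A true].  The
coefficients [c] write [z] as a sum of face boundaries, and the value of such a sum at
[A] is the sum of the coefficients of the two faces. *)
Definition two_basis (G : sgraph) (F : finType) (face : {set G} -> bool -> F) : Prop :=
  (forall f, even_set (boundary face f)) /\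
  (forall z, even_set z -> exists c : F -> bool, forall A, A \in edges G ->
     (A \in z) = c (face A false) (+) c (face A true)).

(** The edge [(false, p)] goes from [p] one step to the right, the edge [(true, p)] one
step up. *)
Definition lattice_edge := (bool * (nat * nat))%type.

Definition lend (e : lattice_edge) (i : bool) : nat * nat :=
  if i then (if e.1 then (e.2.1, e.2.2.+1) else (e.2.1.+1, e.2.2)) else e.2.

(** Unit squares are named by their upper right corner.  The squares with a coordinate 0
lie outside the quadrant, so edges on its border also have two faces. *)
Definition lface (e : lattice_edge) (i : bool) : nat * nat :=
  if i then (if e.1 then (e.2.1, e.2.2.+1) else (e.2.1.+1, e.2.2))
  else (e.2.1.+1, e.2.2.+1).

Lemma adj4_edge p q : adj4 p q -> exists e,
  (lend e false = p /\ lend e true = q) \/ (lend e false = q /\ lend e true = p).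
Proof.
case: p q => [a b] [c d]; rewrite /adj4 /= => /orP[] /andP[/eqP-> /orP[] /eqP->].
- by exists (true, (c, d)); right.
- by exists (true, (c, b)); left.
- by exists (false, (c, d)); right.
- by exists (false, (a, d)); left.
Qed.

(** The boundary of a set of lattice edges: the parity of the number of its edges at
[p]. *)
Definition chain_bd (x : lattice_edge -> bool) (p : nat * nat) : bool :=
  (x (false, p) (+) x (true, p)) (+)
  ((if p.1 is i.+1 then x (false, (i, p.2)) else false) (+)
   (if p.2 is j.+1 then x (true, (p.1, j)) else false)).

Lemma chain_bdD x y p : chain_bd (fun e => x e (+) y e) p = chain_bd x p (+) chain_bd y p.
Proof.
case: p => [[|i] [|j]]; rewrite /chain_bd /=.
- by case: (x _); case: (x _); case: (y _); case: (y _).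
- by case: (x _); case: (x _); case: (x _); case: (y _); case: (y _); case: (y _).
- by case: (x _); case: (x _); case: (x _); case: (y _); case: (y _); case: (y _).
- by case: (x _); case: (x _); case: (x _); case: (x _);
     case: (y _); case: (y _); case: (y _); case: (y _).
Qed.

Lemma chain_bd_sum (I : Type) (r : seq I) (P : pred I) (x : I -> lattice_edge -> bool) p :
  chain_bd (fun e => \big[addb/false]_(i <- r | P i) x i e) p =
  \big[addb/false]_(i <- r | P i) chain_bd (x i) p.
Proof.
elim: r => [|i r IH].
  rewrite big_nil /chain_bd !big_nil; case: p => [[|?] [|?]] //=.
  - by rewrite big_nil.
  - by rewrite big_nil.
  - by rewrite !big_nil.
rewrite big_cons -IH; case: ifP => Pi; last first.
  by congr (chain_bd _ _); apply/funext => e; rewrite big_cons Pi.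
by rewrite -chain_bdD; congr (chain_bd _ _); apply/funext => e; rewrite big_cons Pi.
Qed.

Lemma chain_bd_scale (k : bool) x p : chain_bd (fun e => k && x e) p = k && chain_bd x p.
Proof. by case: k => //; case: p => [[|?] [|?]]. Qed.

Lemma chain_bd_edge e p : chain_bd (fun e' => e' == e) p = (p == lend e false) (+) (p == lend e true).
Proof.
case: e => [[] [a b]]; case: p => [[|i] [|j]];
  rewrite /chain_bd /lend /= ?xpair_eqE /= ?xpair_eqE /=; rewrite ?eqSS ?addbF ?addFb ?andbF //=; lia.
Qed.

Arguments lend : simpl never.
Arguments lface : simpl never.
Lemma reach_chain (S : nat * nat -> Prop) p q : reach S p q ->
  exists x : lattice_edge -> bool,
    (forall e, x e -> S (lend e false) /\ S (lend e true)) /\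
    (forall r, chain_bd x r = (r == p) (+) (r == q)).
Proof.
move=> [w]; elim: w p => [|r w IH] p /=.
  move=> /eqP-> _; exists (fun => false); split=> // r; rewrite addbb.
  by case: r => [[|?] [|?]].
move=> /andP[/andP[pr pw] lw] Sw.
have [||x [xS bx]] := IH r; first by rewrite pw.
  by move=> c cw; apply: Sw; rewrite inE cw orbT.
have Sp : S p by apply: Sw; rewrite inE eqxx.
have Sr : S r by apply: Sw; rewrite !inE eqxx orbT.
have [e he] := adj4_edge pr.
exists (fun e' => (e' == e) (+) x e'); split.
  move=> e2; case: (e2 =P e) => [-> _|_]; last by move=> /= /xS.
  by case: he => [[-> ->]|[-> ->]].
move=> s; rewrite (chain_bdD (fun e' => e' == e)) chain_bd_edge bx.
by case: he => [[-> ->]|[-> ->]]; case: (s == p); case: (s == r); case: (s == q).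
Qed.

Fixpoint row_sum (x : lattice_edge -> bool) (j i : nat) : bool :=
  if i is i'.+1 then row_sum x j i' (+) x (true, (i', j)) else false.

(** The value at a unit square is the number, mod 2, of vertical edges of the chain to
its left in its row: a ray from the square crosses these edges.  The equation for
vertical edges is immediate and the one for horizontal edges follows by induction along
the row, since the chain has even degree at every cell. *)
Lemma closed_chain_face (x : lattice_edge -> bool) : (forall p, chain_bd x p = false) ->
  exists c : nat * nat -> bool, forall e, x e = c (lface e false) (+) c (lface e true).
Proof.
move=> x0; (* the square with upper right corner [(i, j.+1)] lies in the row of the vertical edges [(true, (_, j))] *)
pose c (s : nat * nat) := if s.2 is j.+1 then row_sum x j s.1 else false.
exists c; case=> [[] [i j]]; rewrite /lface /c /=.
  by case: (x _); case: (row_sum _ _ _).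
elim: i => [|i IH] /=.
  have := x0 (0, j); rewrite /chain_bd /=; case: j => [|j] /=.
    by case: (x _); case: (x _).
  by case: (x _); case: (x _); case: (x _).
have := x0 (i.+1, j); rewrite /chain_bd /= IH; case: j {IH} => [|j] /=.
  by case: (x _); case: (x _); case: (x _); case: (row_sum _ _ _).
by case: (x _); case: (x _); case: (x _); case: (x _); case: (x _);
   case: (row_sum _ _ _); case: (row_sum _ _ _).
Qed.

Definition coface (c : nat * nat -> bool) (e : lattice_edge) : bool :=
  c (lface e false) (+) c (lface e true).

(** Each of the four squares around a cell is counted twice.  Cells on the border of the
quadrant have no fourth edge, which is why positive coordinates are assumed. *)
Lemma chain_bd_coface c p : 0 < p.1 -> 0 < p.2 -> chain_bd (coface c) p = false.
Proof.
case: p => [[|i] [|j]] //= _ _; rewrite /chain_bd /coface /lface /=.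
by case: (c _); case: (c _); case: (c _); case: (c _).
Qed.

Lemma addb_sum_mem (T : eqType) (s : seq T) (t : T) : uniq s ->
  \big[addb/false]_(p <- s) (p == t) = (t \in s).
Proof.
elim: s => [|p s IH] /=; first by rewrite big_nil.
move=> /andP[ps us]; rewrite big_cons inE IH // eq_sym.
by case: eqP => // ->; rewrite (negbTE ps).
Qed.

Lemma chain_bd_local (x y : lattice_edge -> bool) p :
  (forall e, (p == lend e false) || (p == lend e true) -> x e = y e) -> chain_bd x p = chain_bd y p.
Proof.
move=> xy; have xyf : x (false, p) = y (false, p) by apply: xy; rewrite eqxx.
have xyt : x (true, p) = y (true, p) by apply: xy; rewrite eqxx.
case: p xy xyf xyt => [[|i] [|j]] xy xyf xyt; rewrite /chain_bd /= xyf xyt //=.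
- by rewrite (xy (true, (0, j))) // eqxx orbT.
- by rewrite (xy (false, (i, 0))) // eqxx orbT.
- by rewrite (xy (false, (i, j.+1))) ?eqxx ?orbT // (xy (true, (i.+1, j))) ?eqxx ?orbT.
Qed.

Lemma chain_bd_finite (L : seq lattice_edge) (x : lattice_edge -> bool) p : uniq L ->
  (forall e, (p == lend e false) || (p == lend e true) -> e \in L) ->
  chain_bd x p = \big[addb/false]_(e <- L) (x e && ((p == lend e false) (+) (p == lend e true))).
Proof.
move=> uL pL; transitivity (chain_bd (fun e' => \big[addb/false]_(e <- L) (x e && (e' == e))) p).
  apply: chain_bd_local => e /pL eL.
  transitivity (x e && \big[addb/false]_(e0 <- L) (e0 == e)).
    by rewrite addb_sum_mem // eL andbT.
  rewrite big_distrr /=; apply: eq_bigr => e0 _.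
  by rewrite eq_sym; case: eqP => [->|]; rewrite ?andbF.
rewrite chain_bd_sum; apply: eq_bigr => e _.
by rewrite chain_bd_scale chain_bd_edge.
Qed.

Section Minor.
Variables (G : sgraph) (C : G -> nat * nat -> Prop) (b : G -> nat * nat) (N : nat).
Hypothesis gm : grid_minor C b N.
Local Notation E := (edges G).

(** Each edge of the graph is represented by one lattice edge between the branch sets of
its end points. *)
Lemma minor_edges : exists gamma : {set G} -> lattice_edge, forall A, A \in E ->
  exists x y, [/\ A = [set x; y]%SET, x != y, C x (lend (gamma A) false)
                & C y (lend (gamma A) true)].
Proof.
suff : forall A : {set G}, exists e, A \in E ->
  exists x y, [/\ A = [set x; y]%SET, x != y, C x (lend e false) & C y (lend e true)].
  by move=> /choice[g hg]; exists g.
move=> A; have [/edgesP[x [y [xy ->]]]|nA] := boolP (A \in E); last first.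
  by exists (true, (0, 0)).
have nxy : x != y by apply/eqP => exy; move: xy; rewrite exy adj_irrefl.
have [p [q [Cp Cq pq]]] := gm_adj gm xy; have [e [[h1 h2]|[h1 h2]]] := adj4_edge pq.
  by exists e => _; exists x, y; rewrite h1 h2.
by exists e => _; exists y, x; rewrite h1 h2 finset.setUC eq_sym.
Qed.

Variable gamma : {set G} -> lattice_edge.
Hypothesis gammaP : forall A, A \in E ->
  exists x y, [/\ A = [set x; y]%SET, x != y, C x (lend (gamma A) false)
                & C y (lend (gamma A) true)].

Lemma gamma_inj A B : A \in E -> B \in E -> gamma A = gamma B -> A = B.
Proof.
move=> /gammaP[x [y [-> _ Cx Cy]]] /gammaP[x' [y' [-> _ Cx' Cy']]] g.
by rewrite g in Cx Cy; rewrite (gm_disj gm Cx Cx') (gm_disj gm Cy Cy').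
Qed.

(** The lattice edges that survive when the minor is formed, either contracted inside a
branch set or kept as an edge of the graph; all other lattice edges are deleted. *)
Definition retained (e : lattice_edge) : Prop :=
  (exists v, C v (lend e false) /\ C v (lend e true)) \/
  (exists2 A, A \in E & e = gamma A).

(** Deleting an edge merges its two faces, so the functions on the faces of the minor are
the functions on unit squares that do not change across a deleted edge. *)
Definition compatible (c : nat * nat -> bool) : Prop :=
  forall e, ~ retained e -> c (lface e false) = c (lface e true).

(** The lattice edge of [A] is completed by walks inside the branch sets of its ends to a
chain from one base cell to the other. *)
Lemma edge_chain A : A \in E -> exists x : lattice_edge -> bool,
  [/\ forall e, x e -> retained e,
      forall B, B \in E -> x (gamma B) = (B == A) &
      forall r, chain_bd x r = \big[addb/false]_(v in A) (r == b v)].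
Proof.
move=> AE; have [u [v [Auv uv Cu Cv]]] := gammaP AE.
have [x [xC bx]] := reach_chain (gm_conn gm Cu).
have [y [yC bY]] := reach_chain (gm_conn gm Cv).
have inner w (z : lattice_edge -> bool) B :
  (forall e, z e -> C w (lend e false) /\ C w (lend e true)) -> B \in E -> z (gamma B) = false.
  move=> zC BE; apply/negP => /zC [h1 h2]; have [u' [v' [_ /eqP uv' Cu' Cv']]] := gammaP BE.
  by apply: uv'; rewrite -(gm_disj gm h1 Cu') -(gm_disj gm h2 Cv').
exists (fun e => (e == gamma A) (+) (x e (+) y e)); split.
- move=> e; case: eqP => [-> _|_ /=]; first by right; exists A.
  have [xe _|nx] := boolP (x e); first by left; exists u; exact: xC.
  by rewrite addFb => ye; left; exists v; exact: yC.
- move=> B BE; rewrite (inner u x) // (inner v y) // !addbF.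
  by apply/eqP/eqP => [/(gamma_inj BE AE)|->].
- move=> r; rewrite (chain_bdD (fun e => e == _)) chain_bdD chain_bd_edge bx bY.
  rewrite Auv (big_setU1 _ _) /= ?inE // big_set1.
  by case: (r == b u); case: (r == b v); case: (r == _); case: (r == _).
Qed.

(** The chains of [edge_chain] for the edges of an even set add up to a closed lattice
chain, because each base cell is the end of an even number of them.  The squares that it
bounds give the required function. *)
Lemma even_set_lift z : even_set z -> exists2 c, compatible c &
  forall A, A \in E -> (A \in z) = coface c (gamma A).
Proof.
move=> [zE zev].
have : forall A : {set G}, exists x : lattice_edge -> bool, A \in E ->
  [/\ forall e, x e -> retained e,
      forall B, B \in E -> x (gamma B) = (B == A) &
      forall r, chain_bd x r = \big[addb/false]_(v in A) (r == b v)].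
  move=> A; have [AE|nA] := boolP (A \in E); last by exists (fun=> false).
  by have [x ?] := edge_chain AE; exists x.
move=> /choice[x hx].
pose X e := \big[addb/false]_(A in z) x A e.
have X0 r : chain_bd X r = false.
  rewrite /X chain_bd_sum.
  under eq_bigr => A Az do rewrite (let: And3 _ _ h := hx A (fintype.subsetP zE _ Az) in h r).
  rewrite (exchange_big_dep xpredT) //= big1 // => v _.
  case: (r == b v); first exact: zev.
  by rewrite big1.
have Xret e : X e -> retained e.
  apply: contraPP => nr; rewrite /X big1 //= => A Az.
  by apply/negP => /(let: And3 h _ _ := hx A (fintype.subsetP zE _ Az) in h e).
have [c hc] := closed_chain_face X0; exists c.
  move=> e ne; have : X e = false by apply/negP => /Xret.
  by rewrite hc; case: (c _); case: (c _).
move=> A AE; rewrite /coface -hc /X.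
under eq_bigr => B Bz do rewrite (let: And3 _ h _ := hx B (fintype.subsetP zE _ Bz) in h A AE).
have [Az|nAz] := boolP (A \in z).
  rewrite (big_setD1 A) //= eqxx big1 // => B; rewrite !inE => /andP[BA _].
  by rewrite eq_sym (negbTE BA).
by rewrite big1 // => B Bz; apply/eqP => AB; move: nAz; rewrite AB Bz.
Qed.

(** Summing over the cells of the branch set of [v] the parities given by
[chain_bd_coface] counts the edges inside the branch set twice and the edges leaving it
once, and the deleted edges contribute nothing. *)
Lemma coface_even c v : compatible c ->
  \big[addb/false]_(A in E | v \in A) coface c (gamma A) = false.
Proof.
move=> cc; pose box := [seq (i, j) | i <- iota 0 N, j <- iota 0 N].
have box_uniq : uniq box.
  by apply: allpairs_uniq; rewrite ?iota_uniq // => -[? ?] [? ?] _ _ [-> ->].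
have boxP i j : ((i, j) \in box) = (i < N) && (j < N).
  apply/allpairsP/andP => [[[i' j'] /= [hi hj [-> ->]]]|[hi hj]].
    by move: hi hj; rewrite !mem_iota.
  by exists (i, j); rewrite /= !mem_iota.
pose P := [seq p <- box | `[< C v p >]].
have uP : uniq P by rewrite filter_uniq.
have PE p : (p \in P) = `[< C v p >].
  rewrite mem_filter; apply: andb_idr => /asboolP /(gm_bound gm) [/andP[_ h1] /andP[_ h2]].
  by rewrite [p]surjective_pairing boxP h1.
pose L := [seq (d, q) | d <- [:: false; true], q <- box].
have uL : uniq L by apply: allpairs_uniq => // -[? ?] [? ?] _ _ [-> ->].
have LP d q : ((d, q) \in L) = (q \in box).
  apply/allpairsP/idP => [[[d' q'] /= [_ hq [_ ->]]] //|hq].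
  by exists (d, q); split=> //; case: (d).
have starL w p e : C w p -> (p == lend e false) || (p == lend e true) -> e \in L.
  move=> /(gm_bound gm) [/andP[_ h1] /andP[_ h2]]; case: e => [d [i j]]; rewrite LP boxP.
  by case: p h1 h2 => [a a'] /=; rewrite /lend /= !xpair_eqE;
    case: d => /=; rewrite ?xpair_eqE; lia.
(* the sum of [w] over all edges of the box [L] vanishes, and [w] selects the edges leaving the branch set *)
pose w e := coface c e && ((lend e false \in P) (+) (lend e true \in P)).
have w0 : \big[addb/false]_(e <- L) w e = false.
  transitivity (\big[addb/false]_(p <- P) chain_bd (coface c) p); last first.
    rewrite big_seq big1 // => p; rewrite PE => /asboolP /(gm_bound gm).
    by move=> [/andP[h1 _] /andP[h2 _]]; exact: chain_bd_coface.
  transitivity (\big[addb/false]_(p <- P) \big[addb/false]_(e <- L)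
     (coface c e && ((p == lend e false) (+) (p == lend e true)))); last first.
    apply: eq_big_seq => p; rewrite PE => /asboolP Cp.
    by rewrite -chain_bd_finite // => e; exact: starL Cp.
  rewrite exchange_big /=; apply: eq_bigr => e _.
  by rewrite -big_distrr /= big_split /= !addb_sum_mem.
have memP A : A \in E -> (lend (gamma A) false \in P) (+) (lend (gamma A) true \in P) = (v \in A).
  move=> /gammaP[x [y [eA xy Cx Cy]]].
  have -> : (lend (gamma A) false \in P) = (v == x).
    by rewrite PE; apply/asboolP/eqP => [h|->//]; exact: (gm_disj gm h Cx).
  have -> : (lend (gamma A) true \in P) = (v == y).
    by rewrite PE; apply/asboolP/eqP => [h|->//]; exact: (gm_disj gm h Cy).
  rewrite [in RHS]eA !inE.
  by case: eqP => // ->; rewrite (negbTE xy).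
have wE e : w e = \big[addb/false]_(A in E | v \in A) (coface c (gamma A) && (e == gamma A)).
  have [[A AE ->]|nA] := pselect (exists2 A, A \in E & e = gamma A).
    rewrite /w memP //; have [vA|nvA] := boolP (v \in A); last first.
      rewrite andbF big1 // => B /andP[BE vB]; case: eqP; rewrite ?andbF // => /(gamma_inj AE BE) AB.
      by move: nvA; rewrite AB vB.
    rewrite (bigD1 A) /= ?AE // eqxx big1 ?addbF // => B /andP[/andP[BE vB] BA].
    by case: eqP; rewrite ?andbF // => /(gamma_inj AE BE) AB; rewrite AB eqxx in BA.
  rewrite big1 => [|A /andP[AE _]]; last first.
    by case: eqP; rewrite ?andbF // => eA; case: nA; exists A.
  rewrite /w; have [[u [h1 h2]]|nu] := pselect (exists u, C u (lend e false) /\ C u (lend e true)).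
    rewrite !PE; have -> : `[< C v (lend e false) >] = `[< C v (lend e true) >].
      by apply/asboolP/asboolP => h; [rewrite (gm_disj gm h h1)|rewrite (gm_disj gm h h2)].
    by rewrite addbb andbF.
  have ne : ~ retained e by case.
  by rewrite /coface (cc e ne) addbb.
transitivity (\big[addb/false]_(e <- L) w e); last exact: w0.
rewrite (eq_bigr _ (fun e _ => wE e)) exchange_big /=.
apply: eq_bigr => A /andP[AE _].
rewrite -big_distrr /= addb_sum_mem //.
have [x [y [_ _ Cx _]]] := gammaP AE.
by rewrite (starL _ _ _ Cx) ?eqxx // andbT.
Qed.
End Minor.

(** Two sides of edges are in the same face when no compatible function tells them apart.
The indicator function of such a class is compatible, so its boundary is even by
[coface_even]; conversely [even_set_lift] writes an even set through a compatible
function, which is constant on classes.  Classes are represented by chosen sides, and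
the sides that represent no class have empty boundary. *)
Lemma grid_minor_two_basis (G : sgraph) (C : G -> nat * nat -> Prop) b N :
  grid_minor C b N -> exists (F : finType) (face : {set G} -> bool -> F), two_basis face.
Proof.
move=> gm; have [gamma gammaP] := minor_edges gm.
pose sq (d : {set G} * bool) := lface (gamma d.1) d.2.
pose compat := compatible C gamma.
pose eqv d d' := forall c, compat c -> c (sq d) = c (sq d').
pose rep d := odflt d [pick d' | `[< eqv d d' >]].
have eqv_rep d : eqv d (rep d).
  by rewrite /rep; case: pickP => [d' /asboolP|].
have rep_eqv d d' : eqv d d' -> rep d = rep d'.
  move=> dd'; rewrite /rep (eq_pick (Q := fun e => `[< eqv d' e >])).
    case: pickP => //= /(_ d') /asboolP []; by [].
  move=> e; apply/asboolP/asboolP => h c cc; first by rewrite -dd' // h.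
  by rewrite dd' // h.
exists ({set G} * bool)%type, (fun A i => rep (A, i)); split.
- move=> f; split; first by apply/fintype.subsetP => A; rewrite inE => /andP[].
  move=> v.
  have [ff|nff] := eqVneq (rep f) f; last first.
    rewrite big1 // => A; rewrite inE => /andP[/andP[_]].
    have nf d : (rep d == f) = false.
      apply/eqP => df; move: nff; rewrite -[X in rep X]df -(rep_eqv _ _ (eqv_rep d)) df.
      by rewrite eqxx.
    by rewrite !nf.
  pose c s := `[< forall c', compat c' -> c' s = c' (sq f) >].
  have cc : compat c.
    move=> e ne; apply/asboolP/asboolP => h c' hc'; last by rewrite hc' // h.
    by rewrite -hc' // h.
  have cE d : c (sq d) = (rep d == f).
    apply/asboolP/eqP => [h|<- c' hc']; first by rewrite -ff; apply: rep_eqv.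
    exact: eqv_rep.
  apply: etrans (coface_even gm gammaP v cc).
  rewrite big_mkcond [RHS]big_mkcond; apply: eq_bigr => A _; rewrite inE /coface.
  rewrite -!(cE (_, _)) /sq /=; case: (A \in _) => //=; case: (v \in A); rewrite ?andbF ?andbT //.
  by case: ifP.
- move=> z /(even_set_lift gm gammaP) [c cc hc]; exists (c \o sq) => A AE.
  by rewrite hc // /coface /= -!eqv_rep.
Qed.

(** * Even sets of edges *)

Lemma addb_sum_const (T : finType) (P : pred T) :
  \big[addb/false]_(t | P t) true = odd #|P|.
Proof.
rewrite big_const; elim: #|P| => //= n ->.
Qed.

Section Parity.
Variable G : sgraph.
Implicit Types (A : {set G}) (z : {set {set G}}).
Local Notation E := (edges G).

Definition parity z (v : G) : bool := \big[addb/false]_A ((A \in z) && (v \in A)).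

Lemma parityE z v : \big[addb/false]_(A in z | v \in A) true = parity z v.
Proof. by rewrite big_mkcond; apply: eq_bigr => A _; case: ifP. Qed.

Lemma parity_card z v : parity z v = odd #|[set A in z | v \in A]%SET|.
Proof.
rewrite -parityE addb_sum_const; congr odd; apply: eq_card => A.
by rewrite !inE.
Qed.

Lemma even_setP z : even_set z <-> z \subset E /\ forall v, parity z v = false.
Proof.
by split=> -[zE h]; split=> // v; [rewrite -parityE|rewrite parityE].
Qed.

Definition symdiff z z' : {set {set G}} := [set A | (A \in z) (+) (A \in z')]%SET.

Lemma parity_symdiff z z' v : parity (symdiff z z') v = parity z v (+) parity z' v.
Proof.
rewrite -big_split; apply: eq_bigr => A _.
by rewrite inE; case: (v \in A); rewrite ?andbT ?andbF.
Qed.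

Lemma symdiff_sub z z' : z \subset E -> z' \subset E -> symdiff z z' \subset E.
Proof.
move=> /fintype.subsetP h /fintype.subsetP h'; apply/fintype.subsetP => A; rewrite inE.
by case: (boolP (A \in z)) => [/h //|_]; case: (boolP (A \in z')) => [/h' //|_].
Qed.

Lemma edge_adj x y : ([set x; y]%SET \in E) = adj x y.
Proof.
apply/edgesP/idP => [[x' [y' [xy e]]]|xy]; last by exists x, y.
have nxy : x' != y' by apply/eqP => exy; move: xy; rewrite exy adj_irrefl.
have : x' \in [set x; y]%SET by rewrite e !inE eqxx.
have : y' \in [set x; y]%SET by rewrite e !inE eqxx orbT.
rewrite !inE => /orP[]/eqP ey /orP[]/eqP ex; move: xy nxy; rewrite ex ey ?eqxx //.
by rewrite adj_sym.
Qed.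

Lemma adj_neq (x y : G) : adj x y -> x != y.
Proof. by move=> xy; apply/eqP => exy; move: xy; rewrite exy adj_irrefl. Qed.

Lemma card_edge A : A \in E -> #|A| = 2.
Proof. by move=> /edgesP[x [y [/adj_neq xy ->]]]; rewrite cards2 xy. Qed.

Lemma pair_inj (v x y : G) : [set v; x]%SET = [set v; y]%SET -> x = y.
Proof.
move=> e; have : x \in [set v; y]%SET by rewrite -e !inE eqxx orbT.
have : y \in [set v; x]%SET by rewrite e !inE eqxx orbT.
by rewrite !inE => /orP[]/eqP -> /orP[] /eqP.
Qed.

Lemma edge_at A v : A \in E -> v \in A -> exists2 x, adj v x & A = [set v; x]%SET.
Proof.
move=> /edgesP[x [y [xy ->]]]; rewrite !inE => /orP[]/eqP->; first by exists y.
by exists x; [rewrite adj_sym|rewrite finset.setUC].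
Qed.

(** Every edge has two ends. *)
Lemma parity_sum z : z \subset E -> \big[addb/false]_v parity z v = false.
Proof.
move=> /fintype.subsetP zE; rewrite exchange_big big1 // => A _.
have [Az|_] := boolP (A \in z); last by rewrite big1.
rewrite /= (eq_bigr (fun v => if v \in A then true else false)); last by move=> v _; case: ifP.
by rewrite -big_mkcond addb_sum_const (eq_card (B := A)) // card_edge // zE.
Qed.

Lemma even_set_edge z v x : even_set z -> [set v; x]%SET \in z ->
  exists2 y, y != x & [set v; y]%SET \in z.
Proof.
move=> /even_setP[/fintype.subsetP zE /(_ v)]; rewrite parity_card => ev vx.
case: (set_0Vmem ([set A in z | v \in A] :\ [set v; x])%SET) => [z0|[A]].
  have : #|[set A in z | v \in A]%SET| = 1%N.
    by rewrite (cardsD1 [set v; x]%SET) z0 cards0 !inE vx eqxx.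
  by move=> c1; rewrite c1 in ev.
rewrite !inE => /and3P[Avx Az vA]; have [y vy eA] := edge_at (zE _ Az) vA.
by exists y; [apply: contraNneq Avx => <-; rewrite eA|rewrite -eA].
Qed.

Lemma set2_eqE (x y u v : G) : ([set x; y]%SET == [set u; v]%SET) =
  (x == u) && (y == v) || (x == v) && (y == u).
Proof.
apply/eqP/orP => [e|[]/andP[/eqP-> /eqP->] //]; last exact: finset.setUC.
have : x \in [set u; v]%SET by rewrite -e !inE eqxx.
rewrite !inE => /orP[]/eqP ex; subst x; [left|right]; rewrite eqxx /=.
  by apply/eqP; apply: pair_inj e.
by apply/eqP; apply: (@pair_inj v); rewrite e finset.setUC.
Qed.

Lemma uniq_leq_card (T : finType) (s : seq T) (B : {set T}) :
  uniq s -> {subset s <= B} -> size s <= #|B|.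
Proof. by move=> us sB; rewrite cardE; apply: uniq_leq_size => // x /sB; rewrite mem_enum. Qed.

(** In a simple graph, leaving a vertex of an even set by a new edge twice gives a path of
three edges. *)
Lemma even_set_ge3 z : even_set z -> z != finset.set0 -> 3 <= #|z|.
Proof.
move=> ez /set0Pn[A Az]; have [/fintype.subsetP zE _] := ez.
have /edgesP[u [v [uv eA]]] := zE _ Az; subst A.
have vu : [set v; u]%SET \in z by rewrite finset.setUC.
have [w wu vw] := even_set_edge ez vu.
have wv : [set w; v]%SET \in z by rewrite finset.setUC.
have [x xv wx] := even_set_edge ez wv.
have nuv := adj_neq uv; have nvw : v != w by apply: adj_neq; rewrite -edge_adj zE.
have nwx : w != x by apply: adj_neq; rewrite -edge_adj zE.
apply: (@uniq_leq_card _ [:: [set u; v]; [set v; w]; [set w; x]]%SET).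
  rewrite /= !inE !set2_eqE (negbTE nuv) ![_ == w]eq_sym (negbTE wu) (eq_sym v x) (negbTE xv).
  by rewrite (eq_sym w v) (negbTE nvw) ?andbF.
by move=> B; rewrite !inE => /or3P[] /eqP->.
Qed.

Lemma even_set_triangle z v x y : even_set z -> #|z| = 3 -> x != y ->
  [set v; x]%SET \in z -> [set v; y]%SET \in z -> [set x; y]%SET \in z.
Proof.
move=> ez z3 xy vx vy; apply: contraT => nxy; have [/fintype.subsetP zE _] := ez.
have xv : [set x; v]%SET \in z by rewrite finset.setUC.
have yv : [set y; v]%SET \in z by rewrite finset.setUC.
have [w wv xw] := even_set_edge ez xv; have [u uv yu] := even_set_edge ez yv.
have nvx : v != x by apply: adj_neq; rewrite -edge_adj zE.
have nvy : v != y by apply: adj_neq; rewrite -edge_adj zE.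
have wy : w != y by apply: contraNneq nxy => <-.
suff : 4 <= #|z| by rewrite z3.
apply: (@uniq_leq_card _ [:: [set v; x]; [set v; y]; [set x; w]; [set y; u]]%SET).
  rewrite /= !inE !set2_eqE.
  rewrite (negbTE nvx) (negbTE nvy) (negbTE xy) (eq_sym v w) (negbTE wv).
  by rewrite (eq_sym v u) (negbTE uv) (negbTE wy) ?andbF ?eqxx.
by move=> B; rewrite !inE => /or4P[] /eqP->.
Qed.

Lemma even_set_quad z : even_set z -> #|z| = 4 -> exists a b c d,
  uniq [:: a; b; c; d] /\
  z = [set [set a; b]; [set b; c]; [set c; d]; [set d; a]]%SET.
Proof.
move=> ez z4; have [/fintype.subsetP zE _] := ez.
have neq x y : [set x; y]%SET \in z -> x != y.
  by move=> xy; apply: adj_neq; rewrite -edge_adj zE.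
have zC x y : [set x; y]%SET \in z -> [set y; x]%SET \in z by rewrite finset.setUC.
have [A Az] : exists A, A \in z by apply/set0Pn; rewrite -card_gt0 z4.
have /edgesP[a [b [nab eA]]] := zE _ Az; subst A; have {}nab := adj_neq nab.
have [c ca bc] := even_set_edge ez (zC _ _ Az).
have [d db ad] := even_set_edge ez Az.
have nbc := neq _ _ bc; have nad := neq _ _ ad.
have [ecd|ncd] := eqVneq c d.
  subst d; pose T3 := [set [set a; b]; [set b; c]; [set a; c]]%SET.
  have T3z : T3 \subset z.
    by apply/fintype.subsetP => B; rewrite !inE => /orP[/orP[]|] /eqP->.
  have cT3 : #|T3| <= 3.
    by rewrite /T3 (leq_trans (leq_card_setU _ _)) // cards1 addn1 cards2; case: (_ != _).
  have [A' ] : exists A', A' \in (z :\: T3)%SET.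
    by apply/set0Pn; rewrite -card_gt0 cardsD (finset.setIidPr T3z) z4 subn_gt0.
  rewrite !inE => /andP[nT3 A'z].
  have /edgesP[p [q [_ eA']]] := zE _ A'z; subst A'.
  have corner u v : [set u; v]%SET \in z -> [set u; v]%SET \notin T3 -> u \in [:: a; b; c].
    move=> uvz uvT; have [r rv ur] := even_set_edge ez uvz.
    have : [set u; r]%SET \in T3.
      apply: contraT => urT; suff : 5 <= #|z| by rewrite z4.
      apply: (@uniq_leq_card _ [:: [set u; v]; [set u; r]; [set a; b]; [set b; c]; [set a; c]]%SET).
        move: uvT urT; rewrite !inE !negb_or => /andP[/andP[h1 h2] h3] /andP[/andP[h4 h5] h6].
        rewrite /= !inE !negb_or h1 h2 h3 h4 h5 h6 /= !set2_eqE.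
        rewrite eqxx (eq_sym v) (negbTE rv) (negbTE nab) (negbTE nbc) (negbTE nad).
        rewrite (eq_sym b a) (negbTE nab) ?andbF ?orbF ?andbT //=.
        by apply/negP => /andP[/eqP eur /eqP evu]; move: rv; rewrite -eur evu eqxx.
      by move=> B; rewrite !inE => /or4P[|||/orP[]] /eqP->.
    by rewrite !inE !set2_eqE => /orP[/orP[]|] /orP[] /andP[-> _]; rewrite ?orbT.
  have np := neq _ _ A'z.
  have pq : p \in [:: a; b; c] by apply: (corner p q) => //; rewrite !inE.
  have qp : q \in [:: a; b; c].
    by apply: (corner q p); [exact: zC|rewrite !inE (finset.setUC [set q]%SET)].
  exfalso; move: nT3 pq qp np; rewrite !inE !set2_eqE => nT.
  by move=> /or3P[]/eqP ep /or3P[]/eqP eq; subst p q; move: nT; rewrite ?eqxx ?orbT ?andbT ?orbT.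
have [e eb ce] := even_set_edge ez (zC _ _ bc).
have [g ga dg] := even_set_edge ez (zC _ _ ad).
have ed : e = d.
  apply/eqP; apply: contraT => ned; suff : 5 <= #|z| by rewrite z4.
  apply: (@uniq_leq_card _ [:: [set a; b]; [set b; c]; [set a; d]; [set c; e]; [set d; g]]%SET).
    rewrite /= !inE !set2_eqE (negbTE nab) (negbTE nad) (negbTE nbc) (negbTE ncd) (negbTE ned).
    rewrite (eq_sym b a) (negbTE nab) (eq_sym a c) (negbTE ca) (eq_sym b d) (negbTE db).
    rewrite (eq_sym b e) (negbTE eb) (eq_sym d c) (negbTE ncd) (eq_sym a g) (negbTE ga).
    by rewrite ?andbF ?orbF ?eqxx /=.
  by move=> B; rewrite !inE => /or4P[|||/orP[]] /eqP->.
subst e; exists a, b, c, d; split.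
  rewrite /= !inE !negb_or nab nad nbc ncd (eq_sym a c) ca (eq_sym b d) db.
  by [].
apply/esym/eqP; rewrite eqEcard z4; apply/andP; split.
  by apply/fintype.subsetP => B; rewrite !inE => /orP[/orP[/orP[]|]|] /eqP-> //; exact: zC.
apply: (@uniq_leq_card _ [:: [set a; b]; [set b; c]; [set c; d]; [set d; a]]%SET).
  rewrite /= !inE !set2_eqE (negbTE nab) (negbTE nbc) (negbTE ncd).
  rewrite (eq_sym a c) (negbTE ca) (eq_sym b d) (negbTE db) (eq_sym d a) (negbTE nad).
  by rewrite ?andbF ?orbF /= ?andbF ?orbF.
by move=> B; rewrite !inE => /or4P[] /eqP->; rewrite ?eqxx ?orbT.
Qed.
End Parity.

(** * Euler's inequality *)

(** The form of the dimension formula used for cycle spaces, where all fibres of a linear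
map are translates of its kernel. *)
Lemma card_fibres (T U : finType) (f : T -> U) (P : {set T}) (Q : {set U}) n :
  (forall t, t \in P -> f t \in Q) ->
  (forall t, t \in P -> #|[set s in P | f s == f t]%SET| <= n) ->
  #|P| <= #|Q| * n.
Proof.
move=> fPQ fib; rewrite -sum1_card (partition_big f (mem Q)) //=.
rewrite -sum_nat_const; apply: leq_sum => u _.
have [[t tP <-]|nt] := pselect (exists2 t, t \in P & f t = u).
  apply: leq_trans (fib t tP); rewrite sum1dep_card; apply/eq_leq/eq_card => s.
  by rewrite !inE.
rewrite big1 // => t /andP[tP /eqP ft]; case: nt; by exists t.
Qed.

Section Euler.
Variables (G : sgraph) (F : finType) (face : {set G} -> bool -> F).
Hypothesis tb : two_basis face.
Local Notation E := (edges G).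
Local Notation bdf := (boundary face).

Definition faces : {set F} := [set f | bdf f != finset.set0]%SET.

Definition cycles : {set {set {set G}}} :=
  [set z in powerset E | [forall v, ~~ parity z v]]%SET.

Lemma cyclesP z : reflect (even_set z) (z \in cycles).
Proof.
rewrite !inE; apply: (iffP andP) => [[zE /forallP h]|/even_setP[zE h]].
  by apply/even_setP; split=> // v; apply: negbTE.
by split=> //; apply/forallP => v; rewrite h.
Qed.

Lemma face_neq A : A \in E -> face A false != face A true ->
  face A false \in faces /\ face A true \in faces.
Proof.
move=> AE ne; split; rewrite inE; apply/set0Pn; exists A; rewrite inE AE eqxx /=.
  by rewrite eq_sym (negbTE ne).
by rewrite (negbTE ne).
Qed.

(** The boundaries of all faces add up to zero, so the coefficients of a cycle can be
normalized to vanish at one chosen face [f0].  A set of coefficients then determines the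
cycle. *)
Lemma card_cycles : #|cycles| <= 2 ^ #|faces|.-1.
Proof.
have /choice[c hc] : forall z, exists c : F -> bool, even_set z ->
    forall A, A \in E -> (A \in z) = c (face A false) (+) c (face A true).
  move=> z.
  have [ez|nz] := pselect (even_set z); last by exists (fun=> false).
  by have [c hc] := tb.2 z ez; exists c.
have eq0 (z : {set {set G}}) : even_set z -> faces = finset.set0 -> z = finset.set0.
  move=> ez F0; apply/setP => A; rewrite inE; apply/negP => Az.
  have AE := fintype.subsetP ez.1 _ Az.
  have [e|/(face_neq AE)[]] := eqVneq (face A false) (face A true); last by rewrite F0 inE.
  by move: Az; rewrite (hc z ez A AE) e addbb.
have [F0|[f0 f0F]] := set_0Vmem faces.
  rewrite F0 cards0 expn0 -(cards1 (finset.set0 : {set {set G}})).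
  apply: subset_leq_card; apply/fintype.subsetP => z /cyclesP ez.
  by rewrite inE (eq0 z ez F0).
pose g (z : {set {set G}}) : {set F} := [set f in faces :\ f0 | c z f (+) c z f0]%SET.
have gE (z : {set {set G}}) f : f \in faces -> c z f = (f \in g z) (+) c z f0.
  move=> fF; rewrite !inE; have [->|nf] := eqVneq f f0; first by [].
  by move: fF; rewrite inE => ->; case: (c z f); case: (c z f0).
have g_inj : {in cycles &, injective g}.
  move=> z z' /cyclesP ez /cyclesP ez' gz.
  apply/setP => A; have [AE|nA] := boolP (A \in E); last first.
    have nin (y : {set {set G}}) : even_set y -> A \in y = false.
      by move=> ey; apply: contraNF nA; exact: (fintype.subsetP ey.1).
    by rewrite !nin.
  rewrite (hc z) // (hc z') //.
  have [->|/(face_neq AE)[h1 h2]] := eqVneq (face A false) (face A true); first by rewrite !addbb.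
  rewrite (gE z _ h1) (gE z _ h2) (gE z' _ h1) (gE z' _ h2) gz.
  by case: (_ \in _); case: (_ \in _); case: (c z f0); case: (c z' f0).
rewrite -(card_in_imset g_inj) (cardsD1 f0 faces) f0F add1n /= -card_powerset.
apply: subset_leq_card; apply/fintype.subsetP => h /imsetP[z _ ->]; rewrite inE.
by apply/fintype.subsetP => f; rewrite inE => /andP[].
Qed.

(** The map from edge sets to the sets of vertices of odd degree has the cycle space as
kernel, and its image consists of subsets of [S] of even size, which are determined by
their part outside one vertex [s0].  With [card_cycles] this bounds the number of all
edge sets. *)
Lemma euler_rank (S : {set G}) : (forall A, A \in E -> A \subset S) -> S != finset.set0 ->
  #|E| <= #|S|.-1 + #|faces|.-1.
Proof.
move=> ES /set0Pn[s0 s0S].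
pose D (z : {set {set G}}) : {set G} := [set v | parity z v]%SET.
have Dout (z : {set {set G}}) v : z \subset E -> v \notin S -> parity z v = false.
  move=> /fintype.subsetP zE vS; rewrite /parity big1 // => A _; apply/negP => /andP[Az vA].
  by move/negP: vS; apply; apply: (fintype.subsetP (ES _ (zE _ Az))).
rewrite -(leq_exp2l (m := 2)) // expnD -card_powerset.
apply: leq_trans (leq_mul (leqnn _) card_cycles).
have -> : 2 ^ #|S|.-1 = #|powerset (S :\ s0)%SET|.
  by rewrite card_powerset (cardsD1 s0 S) s0S.
apply: (card_fibres (f := fun z => (D z :\ s0)%SET)) => [z|z].
  rewrite !inE => zE; apply/fintype.subsetP => v; rewrite !inE => /andP[-> pv] /=.
  by apply: contraTT pv => vS; rewrite Dout.
rewrite inE => zE; set P := [set s in _ | _]%SET.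
have sd_inj : injective (symdiff z).
  move=> x y /setP e; apply/setP => A; have := e A; rewrite !inE.
  by case: (A \in z); case: (A \in x); case: (A \in y).
rewrite -(card_imset _ sd_inj); apply: subset_leq_card.
apply/fintype.subsetP => _ /imsetP[y + ->]; rewrite !inE => /andP[yE /eqP Dyz].
have sE := symdiff_sub zE yE; rewrite sE /=.
have off v : v != s0 -> parity (symdiff z y) v = false.
  move=> vs; have := congr1 (fun X : {set G} => v \in X) Dyz; rewrite !inE vs /= => e.
  by rewrite parity_symdiff e addbb.
apply/forallP => v; have [->|vs] := eqVneq v s0; last by rewrite off.
have := parity_sum sE; rewrite (bigD1 s0) //= big1 => [|u us]; last exact: off.
by rewrite addbF => ->.
Qed.

Lemma boundary_sum : \sum_(f in faces) #|bdf f| =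
  \sum_(A in E) (if face A false == face A true then 0 else 2).
Proof.
transitivity (\sum_f \sum_(A in E) (A \in bdf f : nat)).
  rewrite [LHS]big_mkcond; apply: eq_bigr => f _.
  have -> : \sum_(A in E) (A \in bdf f : nat) = #|bdf f|.
    rewrite -sum1_card [in RHS]big_mkcond [LHS]big_mkcond; apply: eq_bigr => A _.
    by rewrite inE; case: (A \in E) => //=; case: (_ (+) _).
  by case: ifP => //; rewrite inE => /negbFE /eqP->; rewrite cards0.
rewrite exchange_big; apply: eq_bigr => A AE.
under eq_bigr => f _ do rewrite inE AE /=.
have [e|ne] := eqVneq; first by rewrite big1 // => f _; rewrite e addbb.
rewrite (bigD1 (face A false)) //= (bigD1 (face A true)) /=; last by rewrite eq_sym.
rewrite big1 => [|f /andP[f1 f2]]; last by rewrite ![_ == f]eq_sym (negbTE f1) (negbTE f2).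
by rewrite !eqxx eq_sym (negbTE ne).
Qed.

Lemma faces_ge3 : 3 * #|faces| <= 2 * #|E|.
Proof.
apply: (@leq_trans (\sum_(f in faces) #|bdf f|)).
  rewrite mulnC -sum_nat_const; apply: leq_sum => f; rewrite inE => f0.
  exact: even_set_ge3 (tb.1 f) f0.
rewrite boundary_sum mulnC -sum_nat_const; apply: leq_sum => A _.
by case: ifP.
Qed.

Lemma euler_bound (S : {set G}) : (forall A, A \in E -> A \subset S) -> 3 <= #|S| ->
  #|E| + 6 <= 3 * #|S|.
Proof.
move=> ES S3; have S0 : S != finset.set0 by rewrite -card_gt0 (leq_trans _ S3).
have := euler_rank ES S0; have := faces_ge3; lia.
Qed.
End Euler.

Section Induced.
Variables (G : sgraph) (S : {set G}).

Definition induced_adj : rel G := [rel x y | [&& adj x y, x \in S & y \in S]].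

Lemma induced_sym : symmetric induced_adj.
Proof. by move=> x y; rewrite /induced_adj /= adj_sym; case: (x \in S); rewrite ?andbF ?andbT. Qed.

Lemma induced_irrefl : irreflexive induced_adj.
Proof. by move=> x; rewrite /induced_adj /= adj_irrefl. Qed.

Definition induced : sgraph := SGraph induced_sym induced_irrefl.

Lemma induced_edges : edges induced = [set A in edges G | A \subset S]%SET.
Proof.
apply/setP => A; rewrite inE; apply/edgesP/andP => [[x [y [/and3P[xy xS yS] ->]]]|].
  split; first by rewrite edge_adj.
  by apply/fintype.subsetP => v; rewrite !inE => /orP[]/eqP->.
move=> [/edgesP[x [y [xy ->]]] /fintype.subsetP sS]; exists x, y; split=> //.
by apply/and3P; split=> //; apply: sS; rewrite !inE eqxx ?orbT.
Qed.

(** The induced graph keeps all vertices and only drops edges, so the same branch sets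
work. *)
Lemma induced_minor C b N : @grid_minor G C b N -> @grid_minor induced C b N.
Proof.
by case=> h1 h2 h3 h4; split=> // x y /and3P[xy _ _]; exact: h4.
Qed.

Lemma induced_bound C b N : @grid_minor G C b N -> 3 <= #|S| ->
  #|[set A in edges G | A \subset S]%SET| + 6 <= 3 * #|S|.
Proof.
move=> /induced_minor /grid_minor_two_basis[F [face tb]] S3.
rewrite -induced_edges; apply: (euler_bound tb) => // A.
by rewrite induced_edges inE => /andP[].
Qed.
End Induced.

(** * Graphs with 20 vertices and 53 edges *)

Lemma addb_sum_pick (F : finType) (c : F -> bool) a :
  \big[addb/false]_f (c f && (a == f)) = c a.
Proof.
rewrite (bigD1 a) //= eqxx andbT big1 ?addbF // => f fa.
by rewrite eq_sym (negbTE fa) andbF.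
Qed.

Definition nbrs (G : sgraph) (v : G) : {set G} := [set y | adj v y]%SET.

Section Degrees.
Variable G : sgraph.
Local Notation E := (edges G).

Lemma degree_edges (v : G) : degree v = #|[set A in E | v \in A]%SET|.
Proof.
have inj : injective (fun y : G => [set v; y]%SET) by move=> x y; exact: pair_inj.
rewrite /degree -(card_imset _ inj); apply: eq_card => A; rewrite inE.
apply/imsetP/andP => [[y + ->]|[AE vA]].
  by rewrite inE => vy; rewrite edge_adj !inE eqxx.
by have [x vx ->] := edge_at AE vA; exists x; rewrite ?inE.
Qed.

Lemma sum_degree : \sum_(v : G) degree v = 2 * #|E|.
Proof.
transitivity (\sum_(v : G) \sum_(A in E) (v \in A : nat)).
  apply: eq_bigr => v _; rewrite degree_edges -sum1_card big_mkcond [RHS]big_mkcond.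
  by apply: eq_bigr => A _; rewrite inE; case: (A \in E); case: (v \in A).
rewrite exchange_big mulnC -sum_nat_const; apply: eq_bigr => A /= /card_edge <-.
by rewrite -sum1_card [RHS]big_mkcond; apply: eq_bigr => v _; case: (v \in A).
Qed.
End Degrees.

(** The number of edges is one below the maximum 54 for 20 vertices. *)
Section Dense.
Variables (G : sgraph) (C : G -> nat * nat -> Prop) (b : G -> nat * nat) (N : nat).
Hypothesis gm : grid_minor C b N.
Variables (F : finType) (face : {set G} -> bool -> F).
Hypothesis tb : two_basis face.
Local Notation E := (edges G).
Local Notation bdf := (boundary face).
Hypothesis cardG : #|G| = 20.
Hypothesis cardE : #|E| = 53.
Hypothesis min_degree : forall v : G, 5 <= degree v.

(** If [v] were a cut vertex, then the bounds for the two sides, which share [v], would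
leave room for only 3 * 21 - 12 = 51 edges. *)
Lemma two_connected (v : G) (S : {set G}) x0 y0 : v \notin S -> x0 \in S ->
  y0 \notin S -> y0 != v -> exists x y, [/\ x \in S, y \notin S, y != v & adj x y].
Proof.
move=> vS x0S y0S y0v; apply: contrapT => no.
have cl x y : adj x y -> x \in S -> (y == v) || (y \in S).
  move=> xy xS; apply: contraT; rewrite negb_or => /andP[yv yS].
  by case: no; exists x, y.
have ge3 (x : G) (U : {set G}) : nbrs x \subset U -> 3 <= #|U|.
  by move=> /subset_leq_card; apply: leq_trans; exact: leq_trans (min_degree x).
have h1 : 3 <= #|(v |: S)%SET|.
  apply: (ge3 x0); apply/fintype.subsetP => y; rewrite !inE => xy; exact: cl xy x0S.
have h2 : 3 <= #|(~: S)%SET|.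
  apply: (ge3 y0); apply/fintype.subsetP => y; rewrite !inE => xy.
  by apply/negP => yS; rewrite adj_sym in xy; have := cl _ _ xy yS; rewrite (negbTE y0v) (negbTE y0S).
have b1 := induced_bound gm h1; have b2 := induced_bound gm h2.
have cov : E \subset [set A in E | A \subset (v |: S)%SET] :|: [set A in E | A \subset ~: S]%SET.
  apply/fintype.subsetP => A AE; rewrite !inE AE /=.
  move: AE => /edgesP[x [y [xy ->]]]; rewrite !finset.subUset !finset.sub1set !inE.
  have c1 := cl _ _ xy; rewrite adj_sym in xy; have c2 := cl _ _ xy.
  case: (boolP (x \in S)) => xS; case: (boolP (y \in S)) => yS; rewrite ?orbT ?orbF //=.
    by have := c1 xS; rewrite (negbTE yS) orbF => ->.
  by have := c2 yS; rewrite (negbTE xS) orbF => ->.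
have := leq_trans (subset_leq_card cov) (leq_card_setU _ _).
have := cardsC S; rewrite cardsU1 vS cardG cardE in b1 b2 *.
lia.
Qed.

Lemma dense_connected (S : {set G}) : S != finset.set0 ->
  (forall x y, x \in S -> adj x y -> y \in S) -> forall x, x \in S.
Proof.
move=> /set0Pn[x0 x0S] Scl y0; apply: contraT => y0S.
have [v vy0] : exists v, v \in nbrs y0.
  by apply/set0Pn; rewrite -card_gt0; apply: leq_trans (min_degree y0).
rewrite inE adj_sym in vy0.
have vS : v \notin S by apply: contra y0S => vS; exact: Scl vy0.
have y0v : y0 != v by rewrite eq_sym; exact: adj_neq.
have [x [y [xS yS _ xy]]] := two_connected vS x0S y0S y0v.
by case/negP: yS; exact: Scl xy.
Qed.

(** By [two_connected] the vertices that can be linked to [x0] by a chain avoiding [v] are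
all vertices except [v]. *)
Lemma avoiding_chain (v x0 y : G) : x0 != v -> y != v -> exists w : {set {set G}},
  [/\ w \subset E, forall A, A \in w -> v \notin A &
      forall u, parity w u = (u == x0) (+) (u == y)].
Proof.
move=> x0v yv.
pose L y := exists w : {set {set G}},
  [/\ w \subset E, forall A, A \in w -> v \notin A &
      forall u, parity w u = (u == x0) (+) (u == y)].
pose S := [set y | (y != v) && `[< L y >]]%SET.
have x0S : x0 \in S.
  rewrite inE x0v; apply/asboolP; exists finset.set0; split=> [|A|u].
  - exact: finset.sub0set.
  - by rewrite inE.
  - by rewrite addbb /parity big1 // => A _; rewrite inE.
suff : y \in S by rewrite inE => /andP[_ /asboolP].
apply: contraT => yS; have vS : v \notin S by rewrite inE eqxx.
have [p [q [pS qS qv pq]]] := two_connected vS x0S yS yv.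
move: pS qS; rewrite !inE qv /= => /andP[pv /asboolP[w [wE wv wp]]] /asboolP[].
exists (symdiff w [set [set p; q]]%SET); split.
- by apply: symdiff_sub => //; rewrite finset.sub1set edge_adj.
- move=> A; rewrite !inE; have [->|_] := eqVneq A [set p; q]%SET.
    by move=> _; rewrite !inE negb_or !(eq_sym v) pv qv.
  by rewrite addbF => /wv.
- move=> u; rewrite parity_symdiff wp.
  have -> : parity [set [set p; q]]%SET u = (u == p) (+) (u == q).
    rewrite /parity (bigD1 [set p; q]%SET) //= big1 => [|A Apq]; last by rewrite inE (negbTE Apq).
    rewrite !inE eqxx addbF; have [->|] := eqVneq u p; last by [].
    by rewrite (negbTE (adj_neq pq)).
  by case: (u == x0); case: (u == p); case: (u == q).
Qed.

(** Otherwise there is a cycle through [v] with one edge to [X] and one edge to another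
neighbour, by [avoiding_chain].  Every face boundary meets the edges from [v] to [X] an
even number of times, hence so does every sum of face boundaries, but this cycle meets
them once. *)
Lemma link_connected (v : G) (X : {set G}) : X \subset nbrs v -> X != finset.set0 ->
  (forall f x y, x \in X -> [set v; x]%SET \in bdf f -> [set v; y]%SET \in bdf f -> y \in X) ->
  X = nbrs v.
Proof.
move=> Xv /set0Pn[x0 x0X] Xcl; apply/eqP; rewrite finset.eqEsubset Xv /=.
apply/fintype.subsetP => y0 y0v; apply: contraT => y0X; exfalso.
have vx (x : G) : x \in nbrs v -> x != v by rewrite inE => /adj_neq; rewrite eq_sym.
have x0v : x0 \in nbrs v := fintype.subsetP Xv _ x0X.
have [w [wE wv wp]] := avoiding_chain (vx _ x0v) (vx _ y0v).
pose z := symdiff w [set [set v; x0]; [set v; y0]]%SET.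
have ne : [set v; x0]%SET != [set v; y0]%SET.
  by apply: contraNneq y0X => /pair_inj <-.
have ez : even_set z.
  apply/even_setP; split.
    apply: symdiff_sub => //; apply/fintype.subsetP => A; rewrite !inE => /orP[]/eqP->.
      by rewrite edge_adj; move: x0v; rewrite inE.
    by rewrite edge_adj; move: y0v; rewrite inE.
  move=> u; rewrite parity_symdiff wp.
  have -> : parity [set [set v; x0]; [set v; y0]]%SET u = (u == x0) (+) (u == y0).
    rewrite /parity (bigD1 [set v; x0]%SET) //= (bigD1 [set v; y0]%SET) /=; last by rewrite eq_sym.
    rewrite big1 => [|A /andP[A1 A2]]; last by rewrite !inE (negbTE A1) (negbTE A2).
    rewrite !inE !eqxx orbT /= addbF.
    have [->|] := eqVneq u v; last by [].
    by rewrite !(eq_sym v) (negbTE (vx _ x0v)) (negbTE (vx _ y0v)).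
  by rewrite addbb.
pose star : {set {set G}} := [set [set v; x]%SET | x in X]%SET.
have starP x : ([set v; x]%SET \in star) = (x \in X).
  by apply/imsetP/idP => [[x' x'X /pair_inj->] //|xX]; exists x.
have starE A : A \in star -> A \in E.
  move=> /imsetP[x xX ->]; rewrite edge_adj; have := fintype.subsetP Xv _ xX.
  by rewrite inE.
have odd_star : \big[addb/false]_(A in star) (A \in z) = true.
  rewrite (bigD1 [set v; x0]%SET) ?starP //= big1 => [|A /andP[As An]].
    rewrite !inE eqxx /= addbF (contraTF (wv [set v; x0]%SET)) //.
    by rewrite !inE eqxx.
  move: As An => /imsetP[x xX ->] An; rewrite !inE (negbTE An) /=.
  rewrite (contraTF (wv [set v; x]%SET)) ?inE ?eqxx //=.
  by apply: contraNF y0X => /eqP /pair_inj <-.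
have [c hc] := tb.2 z ez.
suff : \big[addb/false]_(A in star) (A \in z) = false by rewrite odd_star.
transitivity (\big[addb/false]_(A in star) \big[addb/false]_f (c f && (A \in bdf f))).
  apply: eq_bigr => A As; rewrite hc ?starE // -(addb_sum_pick c (face A false)) -(addb_sum_pick c (face A true)) -big_split /=.
  apply: eq_bigr => f _; rewrite !inE starE // /=.
  by case: (c f).
rewrite exchange_big big1 //= => f _; rewrite -big_distrr /=.
suff -> : \big[addb/false]_(A in star) (A \in bdf f) = false by rewrite andbF.
have [[A As Af]|none] := pselect (exists2 A, A \in star & A \in bdf f); last first.
  by rewrite big1 // => A As; apply/negP => Af; case: none; exists A.
have [_ pf] := (even_setP _).1 (tb.1 f).
apply: etrans (pf v); rewrite /parity [LHS]big_mkcond; apply: eq_bigr => B _.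
move: As Af => /imsetP[x xX ->] xf.
have [Bs|nBs] := boolP (B \in star).
  by move: Bs => /imsetP[y yX ->]; rewrite !inE eqxx /= andbT.
apply/esym; apply: contraNF nBs => /andP[Bf vB].
have BE : B \in E by move: Bf; rewrite inE => /andP[].
have [y vy eB] := edge_at BE vB; rewrite eB starP.
by apply: (Xcl f x y); rewrite -?eB.
Qed.

(** Euler's inequality gives at least 35 faces.  The sizes of their boundaries are at least
3 and add up to an even number that is at most 106 = 3 * 35 + 1, so everything is forced. *)
Lemma dense_faces : [/\ forall A, A \in E -> face A false != face A true,
  forall f, bdf f != finset.set0 -> #|bdf f| = 3 \/ #|bdf f| = 4 &
  exists2 q, #|bdf q| = 4 & forall f, #|bdf f| = 4 -> f = q].
Proof.
have rk : #|E| <= #|[set: G]|.-1 + #|faces face|.-1.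
  apply: (euler_rank tb); first by move=> A _; apply/fintype.subsetP => x; rewrite inE.
  by rewrite -card_gt0 cardsT cardG.
rewrite cardsT cardG cardE in rk.
have s2 := boundary_sum face.
have ge3 f : f \in faces face -> 3 <= #|bdf f|.
  by rewrite inE; exact: even_set_ge3 (tb.1 f).
have lo (P : pred F) : 3 * #|[set f in faces face | P f]%SET| <=
    \sum_(f in faces face | P f) #|bdf f|.
  rewrite mulnC -sum_nat_const big_mkcond [leqRHS]big_mkcond /=.
  apply: leq_sum => f _; rewrite inE; case: (boolP (f \in faces face)) => //= fF.
  by case: ifP => // _; exact: ge3.
have lo0 : 3 * #|faces face| <= \sum_(f in faces face) #|bdf f|.
  by rewrite mulnC -sum_nat_const; apply: leq_sum => f; exact: ge3.
have neq A : A \in E -> face A false != face A true.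
  move=> AE; apply/negP => eA.
  have : \sum_(B in E) (if face B false == face B true then 0 else 2) <= 104.
    rewrite (bigD1 A) //= eA add0n.
    apply: (@leq_trans (\sum_(B in E | B != A) 2)).
      by apply: leq_sum => B _; case: ifP.
    rewrite sum_nat_cond_const.
    have : #|[set B in E | B != A]%SET| = 52.
      have := cardsD1 A E; rewrite AE cardE => -[] e; rewrite e; apply: eq_card => B.
      by rewrite !inE andbC.
    by rewrite cardsE => ->.
  rewrite -s2; lia.
have s106 : \sum_(f in faces face) #|bdf f| = 106.
  rewrite s2 (eq_bigr (fun=> 2)); last by move=> A /neq /negbTE ->.
  by rewrite sum_nat_const cardE.
have c35 : #|faces face| = 35 by lia.
have rest q : q \in faces face -> \sum_(f in faces face | f != q) #|bdf f| + #|bdf q| = 106.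
  by move=> qF; have := s106; rewrite (bigD1 q) //=; lia.
have crest q : q \in faces face -> #|[set f in faces face | f != q]%SET| = 34.
  move=> qF; have := cardsD1 q (faces face); rewrite qF c35 => -[] ->.
  by apply: eq_card => f; rewrite !inE andbC.
have le4 f : f \in faces face -> #|bdf f| <= 4.
  by move=> fF; have := rest f fF; have := lo (fun g => g != f); rewrite (crest f fF); lia.
split=> //.
  by move=> f f0; have fF : f \in faces face by [rewrite inE]; have := le4 f fF; have := ge3 f fF; lia.
have [q qF q4] : exists2 q, q \in faces face & #|bdf q| = 4.
  apply: contrapT => no.
  have : \sum_(f in faces face) #|bdf f| = \sum_(f in faces face) 3.
    apply: eq_bigr => f fF; have := ge3 f fF; have := le4 f fF.
    have : #|bdf f| <> 4 by move=> f4; case: no; exists f.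
    by lia.
  by rewrite s106 sum_nat_const c35.
exists q => // f f4; apply/eqP; apply: contraT => fq.
have fF : f \in faces face by rewrite inE -card_gt0 f4.
have r := rest q qF; rewrite (bigD1 f) /= in r; last by rewrite fF.
rewrite (eq_bigl (fun i => (i \in faces face) && ((i != q) && (i != f)))) in r; last first.
  by move=> i; rewrite andbA.
have := lo (fun g => (g != q) && (g != f)).
have -> : #|[set g in faces face | (g != q) && (g != f)]%SET| = 33.
  have := cardsD1 f [set g in faces face | g != q]%SET; rewrite inE fF fq crest // => -[] ->.
  by rewrite add0n; apply: eq_card => g; rewrite !inE [RHS]andbC andbA.
move=> l; suff : 4 + 3 * 33 + 4 <= 106 by [].
by rewrite -r f4 q4 leq_add2r leq_add2l; exact: l.
Qed.
End Dense.

(** * The near-triangulation *)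

(** Decides the equality tests between vertices that are known to be different, which arise
from duplicate-free lists of edges. *)
Ltac use_neq := repeat match goal with H : is_true (?p != ?q) |- _ =>
  let H1 := fresh in let H2 := fresh in
  have H1 : (p == q) = false by [exact: negbTE H];
  have H2 : (q == p) = false by [rewrite eq_sym; exact: H1];
  rewrite ?H1 ?H2; clear H H1 H2 end; rewrite ?eqxx ?andbF ?orbF /= ?andbF ?orbF.

(** The triples [(v, x, y)] such that [x] and [y] are the neighbours of [v] on the
quadrangle [a], [b], [c], [d]. *)
Definition quad_corners (T : eqType) (a b c d : T) : seq (T * T * T) :=
  [:: (a, b, d); (a, d, b); (b, a, c); (b, c, a); (c, b, d); (c, d, b); (d, a, c); (d, c, a)].

Definition quad_sides (T : eqType) (a b c d : T) : seq (T * T) :=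
  [:: (a, b); (b, a); (b, c); (c, b); (c, d); (d, c); (d, a); (a, d)].

Lemma quad_sides_corner (T : eqType) (a b c d v x y : T) : uniq [:: a; b; c; d] -> y != x ->
  (v, x) \in quad_sides a b c d -> (v, y) \in quad_sides a b c d ->
  (v, x, y) \in quad_corners a b c d.
Proof.
rewrite /quad_sides /= !inE !negb_or => /and4P[/and3P[ab ac ad] /andP[bc bd] cd _].
move=> yx; rewrite !xpair_eqE; move: yx.
have [va|va] := eqVneq v a; last have [vb|vb] := eqVneq v b;
  last have [vc|vc] := eqVneq v c; last have [vd|vd] := eqVneq v d.
1-4: by subst v; use_neq => yx /orP[]/eqP ex /orP[]/eqP ey; move: yx; rewrite ex ey ?eqxx ?orbT.
by use_neq.
Qed.

(** The set [lk v x] consists of the vertices that follow or precede [x] in the cyclic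
sequence of neighbours around [v]: the pairs of consecutive neighbours are the corners of
faces at [v].  All corners come from triangles except those of one quadrangle, and the
last field says that the neighbours of [v] form a single cyclic sequence. *)
Record near_triangulation (G : sgraph) (lk : G -> G -> {set G}) (a b c d : G) : Prop :=
  NearTriangulation {
    nt_adj : forall v x y, y \in lk v x -> [/\ adj v x, adj v y & y != x];
    nt_card : forall v x, adj v x -> #|lk v x| = 2;
    nt_sym : forall v x y, y \in lk v x -> x \in lk v y;
    nt_face : forall v x y, y \in lk v x ->
      y \in lk x v /\ x \in lk y v \/ (v, x, y) \in quad_corners a b c d;
    nt_quad : uniq [:: a; b; c; d] /\
      forall v x y, (v, x, y) \in quad_corners a b c d -> y \in lk v x;
    nt_link : forall v (X : {set G}), X \subset nbrs v -> X != finset.set0 ->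
      (forall x, x \in X -> lk v x \subset X) -> X = nbrs v }.

Section Links.
Variables (G : sgraph) (C : G -> nat * nat -> Prop) (b : G -> nat * nat) (N : nat).
Hypothesis gm : grid_minor C b N.
Variables (F : finType) (face : {set G} -> bool -> F).
Hypothesis tb : two_basis face.
Local Notation E := (edges G).
Local Notation bdf := (boundary face).
Hypothesis cardG : #|G| = 20.
Hypothesis cardE : #|E| = 53.
Hypothesis min_degree : forall v : G, 5 <= degree v.

Definition lk (v x : G) : {set G} :=
  [set y | (y != x) && [exists f, ([set v; x]%SET \in bdf f) && ([set v; y]%SET \in bdf f)]]%SET.

Lemma lkP v x y : reflect (y != x /\ exists2 f, [set v; x]%SET \in bdf f & [set v; y]%SET \in bdf f)
  (y \in lk v x).
Proof.
rewrite inE; apply: (iffP andP) => [[yx /existsP[f /andP[h1 h2]]]|[yx [f h1 h2]]]; split=> //.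
  by exists f.
by apply/existsP; exists f; rewrite h1.
Qed.

Lemma bdf_adj f v x : [set v; x]%SET \in bdf f -> adj v x.
Proof. by rewrite inE => /andP[]; rewrite edge_adj. Qed.

Lemma face_card f A : A \in bdf f -> #|bdf f| = 3 \/ #|bdf f| = 4.
Proof.
have [_ h _] := dense_faces tb cardG cardE.
by move=> Af; apply: h; apply/set0Pn; exists A.
Qed.

(** A boundary with at least three edges at [v] also has one more edge at each of their
other ends, which makes at least five edges. *)
Lemma bdf_two f v x y y' : [set v; x]%SET \in bdf f -> [set v; y]%SET \in bdf f ->
  [set v; y']%SET \in bdf f -> y != x -> y' != x -> y = y'.
Proof.
move=> fx fy fy' yx y'x; apply/eqP; apply: contraT => yy'.
have ef := tb.1 f.
have fC p q : [set p; q]%SET \in bdf f -> [set q; p]%SET \in bdf f by rewrite finset.setUC.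
have c4 : #|bdf f| <= 4 by case: (face_card fx) => ->.
have [w wv xw] := even_set_edge ef (fC _ _ fx).
have [w' w'v yw'] := even_set_edge ef (fC _ _ fy).
have [w2 w2v yw2] := even_set_edge ef (fC _ _ fy').
have vx := adj_neq (bdf_adj fx); have vy := adj_neq (bdf_adj fy).
have vy' := adj_neq (bdf_adj fy').
suff : 5 <= #|bdf f| by move=> h; have := leq_trans h c4.
have [e|ne] := eqVneq [set x; w]%SET [set y; w']%SET.
  have ewy : w = y.
    by move/eqP: e; rewrite set2_eqE eq_sym (negbTE yx) /= => /andP[_ /eqP].
  subst w; apply: (@uniq_leq_card _ [:: [set v; x]; [set v; y]; [set v; y']; [set x; y]; [set y'; w2]]%SET).
    by rewrite /= !inE !set2_eqE; use_neq.
  by apply/allP; rewrite /= fx fy fy' xw yw2.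
have [e2|ne2] := eqVneq [set x; w]%SET [set y'; w2]%SET.
  have ewy : w = y'.
    by move/eqP: e2; rewrite set2_eqE eq_sym (negbTE y'x) /= => /andP[_ /eqP].
  subst w; apply: (@uniq_leq_card _ [:: [set v; x]; [set v; y]; [set v; y']; [set x; y']; [set y; w']]%SET).
    by clear ne; rewrite /= !inE !set2_eqE; use_neq.
  by apply/allP; rewrite /= fx fy fy' xw yw'.
apply: (@uniq_leq_card _ [:: [set v; x]; [set v; y]; [set v; y']; [set x; w]; [set y; w']]%SET).
  by rewrite /= !inE (negbTE ne) !set2_eqE; clear ne; use_neq.
by apply/allP; rewrite /= fx fy fy' xw yw'.
Qed.

Lemma edge_two_faces A : A \in E -> exists f0 f1,
  [/\ f0 != f1, A \in bdf f0, A \in bdf f1 & forall f, A \in bdf f -> f = f0 \/ f = f1].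
Proof.
move=> AE; have [/(_ A AE) ne _ _] := dense_faces tb cardG cardE.
exists (face A false), (face A true); split=> //.
- by rewrite inE AE eqxx eq_sym (negbTE ne).
- by rewrite inE AE eqxx (negbTE ne).
- move=> f; rewrite inE AE /=; have [->|_] := eqVneq (face A false) f; first by left.
  by move=> /eqP ->; right.
Qed.

Lemma bdf_next f v x : [set v; x]%SET \in bdf f -> exists2 y, y != x & [set v; y]%SET \in bdf f.
Proof. exact: even_set_edge (tb.1 f). Qed.

Lemma link_small_proper (v x y : G) : adj v x -> adj v y ->
  exists2 t, t \in nbrs v & t \notin [set x; y]%SET.
Proof.
move=> vx vy; have : 0 < #|nbrs v :\: [set x; y]|%SET.
  rewrite cardsD; have := min_degree v; rewrite /degree -/(nbrs v) => d5.
  have : #|(nbrs v :&: [set x; y])%SET| <= 2.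
    by apply: leq_trans (subset_leq_card (subsetIr _ _)) _; rewrite cards2; case: (_ != _).
  by lia.
by rewrite card_gt0 => /set0Pn[t]; rewrite finset.inE => /andP[h1 h2]; exists t.
Qed.

(** The two faces at the edge contribute one neighbour each.  If these were the same vertex
[y0], then the pair of [x] and [y0] would be closed under passing to the next neighbour,
against [link_connected]. *)
Lemma card_lk (v x : G) : adj v x -> #|lk v x| = 2.
Proof.
move=> vx; have vxE : [set v; x]%SET \in E by rewrite edge_adj.
have [f0 [f1 [nf h0 h1 hf]]] := edge_two_faces vxE.
have [y0 y0x v0] := bdf_next h0; have [y1 y1x v1] := bdf_next h1.
have ne : y0 != y1.
  apply/eqP => e; subst y1.
  have [t tv] := link_small_proper vx (bdf_adj v0).
  suff -> : [set x; y0]%SET = nbrs v by rewrite tv.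
  apply: (link_connected gm tb cardG cardE min_degree).
  - apply/fintype.subsetP => u; rewrite !inE => /orP[]/eqP->//; exact: bdf_adj v0.
  - by apply/set0Pn; exists x; rewrite !inE eqxx.
  have fx f q : f = f0 \/ f = f1 -> [set v; q]%SET \in bdf f -> q \in [set x; y0]%SET.
    move=> ff fq; rewrite !inE; have [//|qx] := eqVneq q x; apply/eqP.
    by case: ff => ef; subst f; [exact: bdf_two h0 fq v0 qx y0x|exact: bdf_two h1 fq v1 qx y0x].
  move=> f p q pX fp fq; have {pX} [ep|ep] : p = x \/ p = y0.
      by move: pX; rewrite !inE => /orP[]/eqP; [left|right].
    by subst p; exact: fx (hf f fp) fq.
  subst p.
  have [g0 [g1 [ng k0 k1 kf]]] := edge_two_faces (fintype.subsetP (tb.1 f0).1 _ v0).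
  apply: (fx f) fq.
  have [a0 a1] : (f0 = g0 \/ f0 = g1) /\ (f1 = g0 \/ f1 = g1) by split; exact: kf.
  case: (kf f fp) => ->; case: a0 => e0; case: a1 => e1; rewrite ?e0 ?e1; auto.
  - by move: nf; rewrite e0 e1 eqxx.
  - by move: nf; rewrite e0 e1 eqxx.
suff -> : lk v x = [set y0; y1]%SET by rewrite cards2 ne.
apply/setP => y; rewrite [y \in [set _; _]%SET]inE !finset.in_set1.
apply/lkP/orP => [[yx [f fx fy]]|[]/eqP->].
- case: (hf f fx) => ef; subst f; [left|right]; apply/eqP.
    exact: bdf_two h0 fy v0 yx y0x.
  exact: bdf_two h1 fy v1 yx y1x.
- by split=> //; exists f0.
- by split=> //; exists f1.
Qed.

Lemma dense_near_triangulation : exists a b c d, near_triangulation lk a b c d.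
Proof.
have [neq c34 [q q4 qu]] := dense_faces tb cardG cardE.
have [a [b' [c [d [abcd eq]]]]] := even_set_quad (tb.1 q) q4.
have nlk v x y f : x != y -> [set v; x]%SET \in bdf f -> [set v; y]%SET \in bdf f -> y \in lk v x.
  by move=> xy h1 h2; apply/lkP; split; [rewrite eq_sym|exists f].
exists a, b', c, d; split.
- move=> v x y /lkP[yx [f fx fy]]; split=> //; [exact: bdf_adj fx|exact: bdf_adj fy].
- exact: card_lk.
- by move=> v x y /lkP[yx [f fx fy]]; apply: (nlk _ _ _ f).
- move=> v x y /lkP[yx [f fx fy]].
  have vx := adj_neq (bdf_adj fx); have vy := adj_neq (bdf_adj fy).
  have [f3|f4] := face_card fx.
    have xy := even_set_triangle (tb.1 f) f3 yx fy fx.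
    left; split; apply: (nlk _ _ _ f) => //; by rewrite finset.setUC.
  right; have ? := qu f f4; subst f.
  have sides p r : [set p; r]%SET \in bdf q -> (p, r) \in quad_sides a b' c d.
    by rewrite eq !inE !set2_eqE !xpair_eqE -!orbA.
  by apply: quad_sides_corner => //; exact: sides.
- split=> //; have h (x y : G) : [set x; y]%SET \in [:: [set a; b']; [set b'; c]; [set c; d]; [set d; a]]%SET ->
    [set x; y]%SET \in bdf q /\ [set y; x]%SET \in bdf q.
    rewrite (finset.setUC [set y]%SET) eq !inE => /or4P[] ->; by rewrite ?orbT.
  have [ab ab'] : _ /\ _ := h a b' ltac:(by rewrite !inE eqxx ?orbT).
  have [bc bc'] : _ /\ _ := h b' c ltac:(by rewrite !inE eqxx ?orbT).
  have [cd cd'] : _ /\ _ := h c d ltac:(by rewrite !inE eqxx ?orbT).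
  have [da da'] : _ /\ _ := h d a ltac:(by rewrite !inE eqxx ?orbT).
  have nac : a != c by move: abcd; rewrite /= !inE !negb_or; case/and4P=> /and3P[].
  have nbd : b' != d by move: abcd; rewrite /= !inE !negb_or; case/and4P=> _ /andP[].
  have : all (fun t => t.2 \in lk t.1.1 t.1.2) (quad_corners a b' c d).
    by rewrite /=; repeat (apply/andP; split) => //; apply: (nlk _ _ _ q) => //; rewrite eq_sym.
  by move=> /allP h' v x y /h'.
- move=> v X Xv X0 Xcl; apply: (link_connected gm tb cardG cardE min_degree) => //.
  move=> f x y xX fx fy; have [->//|yx] := eqVneq y x.
  by apply: (fintype.subsetP (Xcl x xX)); apply/lkP; split=> //; exists f.
Qed.
End Links.

(** * The search *)

(** What is known around one vertex: each entry consists of a neighbour and the list of the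
neighbours that are known to be next to it. *)
Definition link := seq (nat * seq nat).

Fixpoint around (a : nat) (l : link) : seq nat :=
  if l is (a', m) :: l' then (if eqn a' a then m else around a l') else [::].

Fixpoint push (a b : nat) (l : link) : link :=
  if l is (a', m) :: l' then
    (if eqn a' a then (a', b :: m) :: l' else (a', m) :: push a b l')
  else [:: (a, [:: b])].

Definition add_corner (a b : nat) (l : link) : link :=
  if has (eqn b) (around a l) then l else push a b (push b a l).

(** A vertex of degree [d] has at most [d] neighbours, each next to two others, and when no
neighbour waits for a further one, the cyclic sequence is closed and must contain all [d]
of them. *)
Definition link_ok (d : nat) (l : link) : bool :=
  [&& size l <= d, all (fun p => size p.2 <= 2) l &
      all (fun p => eqn (size p.2) 2) l ==> eqn (size l) d].

(** The degrees and the links of the vertices found so far, which are numbered in the order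
of their discovery. *)
Definition state := (seq nat * seq link)%type.

Definition linkof (s : state) (v : nat) : link := nth [::] s.2 v.
Definition degof (s : state) (v : nat) : nat := nth 0 s.1 v.

(** The list has one element if the triangle passes the test at its three corners and none
otherwise. *)
Definition add_triangle (s : state) (v w y : nat) : seq state :=
  let ly := add_corner v w (linkof s y) in
  if link_ok (degof s y) ly then
    let lv := add_corner w y (linkof s v) in
    if link_ok (degof s v) lv then
      let lw := add_corner v y (linkof s w) in
      if link_ok (degof s w) lw then
        [:: (s.1, set_nth [::] (set_nth [::] (set_nth [::] s.2 v lv) w lw) y ly)]
      else [::]
    else [::]
  else [::].

Definition add_vertex (s : state) (d : nat) : state := (rcons s.1 d, rcons s.2 [::]).

(** The possible third vertices of the second triangle at the edge from [v] to [w]: the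
known ones, and a new one of degree 5 or 7 as long as the degree sequence allows it. *)
Definition children (s : state) (v w : nat) : seq state :=
  let k := size s.1 in
  flatten [seq add_triangle s v w y | y <- iota 0 k &
    [&& ~~ eqn y v, ~~ eqn y w & ~~ has (eqn y) (around w (linkof s v))]] ++
  (if count (eqn 5) s.1 < 17 then add_triangle (add_vertex s 5) v w k else [::]) ++
  (if count (eqn 7) s.1 < 3 then add_triangle (add_vertex s 7) v w k else [::]).

Fixpoint half_open (l : link) : option nat :=
  if l is (a, m) :: l' then (if eqn (size m) 1 then Some a else half_open l') else None.

Definition corners (l : link) : nat := foldr (fun p n => size p.2 + n) 0 l.

(** The search continues at a vertex with as few missing faces as possible.  The choice is a
heuristic: [refuted] checks what it needs about the result. *)
Fixpoint pick_side (ds : seq nat) (ls : seq link) (i : nat) (best : option (nat * nat * nat)) :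
    option (nat * nat * nat) :=
  match ds, ls with
  | d :: ds', l :: ls' =>
    let score := d.*2 - corners l in
    let better := if best is Some (sc, _, _) then score < sc else true in
    if better then
      if half_open l is Some w then pick_side ds' ls' i.+1 (Some (score, i, w))
      else pick_side ds' ls' i.+1 best
    else pick_side ds' ls' i.+1 best
  | _, _ => best
  end.

Fixpoint refuted (fuel : nat) (s : state) : bool :=
  if fuel is n.+1 then
    if pick_side s.1 s.2 0 None is Some (_, v, w) then
      [&& v < size s.1, eqn (size (around w (linkof s v))) 1 &
          all (refuted n) (children s v w)]
    else all (fun l => all (fun p => eqn (size p.2) 2) l) s.2 && (size s.1 < 20)
  else false.

Definition start (d0 d1 d2 d3 : nat) : state :=
  ([:: d0; d1; d2; d3],
   [:: [:: (1, [:: 3]); (3, [:: 1])]; [:: (0, [:: 2]); (2, [:: 0])];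
       [:: (1, [:: 3]); (3, [:: 1])]; [:: (0, [:: 2]); (2, [:: 0])]]).

(** Up to rotation, the degree patterns of a quadrangle with at most three vertices of
degree 7. *)
Definition all_refuted : bool :=
  [&& refuted 100 (start 5 5 5 5), refuted 100 (start 5 5 5 7), refuted 100 (start 5 5 7 7),
      refuted 100 (start 5 7 5 7) & refuted 100 (start 5 7 7 7)].

(** * Soundness of the search *)

Lemma around_push a b l x :
  around x (push a b l) = if x == a then b :: around a l else around x l.
Proof.
elim: l => [|[a' m] l IH] /=.
  by change (eqn a x) with (a == x); rewrite eq_sym; case: eqP.
change (eqn a' a) with (a' == a); change (eqn a' x) with (a' == x).
have [ea|na] := eqVneq a' a; rewrite /=; change (eqn a' x) with (a' == x).
  by rewrite ea (eq_sym a x); case: eqP.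
rewrite IH; have [ex|nx] := eqVneq a' x; last by [].
by rewrite -ex (negbTE na).
Qed.

Lemma unzip1_push a b l : unzip1 (push a b l) =
  if a \in unzip1 l then unzip1 l else rcons (unzip1 l) a.
Proof.
elim: l => [|[a' m] l IH] //=.
change (eqn a' a) with (a' == a); rewrite inE (eq_sym a a').
by have [ea|na] := eqVneq a' a; rewrite //= IH; case: ifP.
Qed.

Lemma uniq_push a b l : uniq (unzip1 l) -> uniq (unzip1 (push a b l)).
Proof. by rewrite unzip1_push; case: ifP => // /negbT h ul; rewrite rcons_uniq h. Qed.

Lemma push_nonempty a b l : all (fun p => p.2 != [::]) l ->
  all (fun p => p.2 != [::]) (push a b l).
Proof.
elim: l => [|[a' m] l IH] //= /andP[m0 l0].
by case: ifP => _ /=; rewrite ?l0 // m0 IH.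
Qed.

Lemma around_mem l p : uniq (unzip1 l) -> p \in l -> around p.1 l = p.2.
Proof.
elim: l => [|[a' m] l IH] //= /andP[al ul]; rewrite inE => /orP[/eqP->|pl] /=.
  by change (eqn a' a') with (a' == a'); rewrite eqxx.
change (eqn a' p.1) with (a' == p.1); have [e|_] := eqVneq; last exact: IH.
by move: al; rewrite e; case/negP; apply: map_f.
Qed.

Lemma around_key x y l : y \in around x l -> x \in unzip1 l.
Proof.
elim: l => [|[a' m] l IH] //=; change (eqn a' x) with (a' == x); rewrite inE.
by have [_|_] := eqVneq a' x; rewrite //= => /IH ->; rewrite orbT.
Qed.

Section Search.
Variables (G : sgraph) (lk : G -> G -> {set G}) (a b c d : G).
Hypothesis nt : near_triangulation lk a b c d.
Hypothesis cardG : #|G| = 20.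
Hypothesis degrees : forall v : G, degree v = 5 \/ degree v = 7.
Hypothesis degree5 : #|[set v : G | degree v == 5]%SET| = 17.
Hypothesis degree7 : #|[set v : G | degree v == 7]%SET| = 3.
Hypothesis connected : forall S : {set G}, S != finset.set0 ->
  (forall x y, x \in S -> adj x y -> y \in S) -> forall x, x \in S.

Implicit Types (t : seq G) (l : link) (s : state).
Local Notation pt t i := (nth a t i).

(** The list [t] gives the vertices of the graph that the numbers in a state stand for. *)
Record link_sound t (v : G) l : Prop := LinkSound {
  ls_keys : uniq (unzip1 l);
  ls_nonempty : all (fun p => p.2 != [::]) l;
  ls_uniq : forall x, uniq (around x l);
  ls_real : forall x y, y \in around x l ->
    [/\ x < size t, y < size t, pt t y \in lk v (pt t x) & x \in around y l] }.

Lemma add_corner_sound t v l x y : link_sound t v l -> uniq t -> x < size t -> y < size t ->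
  pt t y \in lk v (pt t x) ->
  [/\ link_sound t v (add_corner x y l), y \in around x (add_corner x y l)
    & forall x' y', y' \in around x' l -> y' \in around x' (add_corner x y l)].
Proof.
move=> [k1 k2 k3 k4] ut xt yt yx; rewrite /add_corner.
have -> : has (eqn y) (around x l) = (y \in around x l).
  by apply/hasP/idP => [[z zl /eqnP->] //|yl]; exists y => //; exact/eqnP.
case: ifP => [yl|/negbT nyl]; first by split=> //; split.
have xy : x != y.
  by have [_ _] := nt_adj nt yx; apply: contraNneq => ->.
have nxl : x \notin around y l by apply: contra nyl => /k4[].
have eA z : around z (push x y (push y x l)) =
    if z == x then y :: around x l else if z == y then x :: around y l else around z l.
  by rewrite !around_push (negbTE xy).
split.
- split.
  + by do 2 apply: uniq_push.
  + by rewrite !push_nonempty.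
  + by move=> z; rewrite eA; do 2?case: ifP => _ //=; rewrite ?nyl ?nxl k3.
  + move=> p q; rewrite !eA; have [->|px] := eqVneq p x.
      rewrite inE => /orP[/eqP->|ql]; first by rewrite eq_sym (negbTE xy) eqxx inE eqxx.
      have [h1 h2 h3 h4] := k4 _ _ ql; split=> //.
      have [eq|qx] := eqVneq q x; first by move: h3; rewrite eq => /(nt_adj nt)[_ _]; rewrite eqxx.
      by have [_|//] := eqVneq q y; rewrite inE eqxx.
    have [->|py] := eqVneq p y.
      rewrite inE => /orP[/eqP->|ql].
        by rewrite eqxx inE eqxx; split=> //; exact: (nt_sym nt).
      have [h1 h2 h3 h4] := k4 _ _ ql; split=> //.
      have [_|qx] := eqVneq q x; first by rewrite inE eqxx.
      by have [eq|//] := eqVneq q y; rewrite inE; move: h4; rewrite eq => ->; rewrite orbT.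
    move=> ql; have [h1 h2 h3 h4] := k4 _ _ ql; split=> //.
    have [eq|qx] := eqVneq q x; first by rewrite inE; move: h4; rewrite eq => ->; rewrite orbT.
    by have [eq|//] := eqVneq q y; rewrite inE; move: h4; rewrite eq => ->; rewrite orbT.
- by rewrite eA eqxx inE eqxx.
- move=> p q; rewrite eA; have [->|_] := eqVneq p x; first by rewrite inE => ->; rewrite orbT.
  by have [->|//] := eqVneq p y; rewrite inE => ->; rewrite orbT.
Qed.

Lemma link_bound t v l p : link_sound t v l -> uniq t -> p \in l ->
  [/\ p.1 < size t, pt t p.1 \in nbrs v, size p.2 <= 2 &
      size p.2 = 2 -> forall u, u \in lk v (pt t p.1) ->
        exists2 y, y \in unzip1 l & u = pt t y].
Proof.
move=> [k1 k2 k3 k4] ut pl; have ep := around_mem k1 pl.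
have m0 : p.2 != [::] := allP k2 _ pl.
have [y yp] : exists y, y \in p.2.
  by case: (p.2) m0 => // y m _; exists y; rewrite inE eqxx.
have yr := yp; rewrite -ep in yr; have [pk yk ylk _] := k4 _ _ yr.
have [vx vy yx] := nt_adj nt ylk.
pose U := [seq pt t z | z <- p.2].
have Ur : {subset U <= lk v (pt t p.1)}.
  by move=> _ /mapP[z zp ->]; rewrite -ep in zp; have [] := k4 _ _ zp.
have Uu : uniq U.
  rewrite map_inj_in_uniq; first by rewrite -ep.
  move=> z z'; rewrite -ep => /k4[_ zk _ _] /k4[_ zk' _ _] /eqP.
  by rewrite nth_uniq // => /eqP.
split=> //; first by rewrite inE.
  by have := uniq_leq_card Uu Ur; rewrite (nt_card nt vx) size_map.
move=> p2 u ulk; have : u \in U.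
  have s1 : {subset U <= enum (lk v (pt t p.1))} by move=> z /Ur; rewrite mem_enum.
  have s2 : size (enum (lk v (pt t p.1))) <= size U.
    by rewrite -cardE (nt_card nt vx) size_map p2.
  have [_ h] := uniq_min_size Uu s1 s2.
  by rewrite h mem_enum.
move=> /mapP[z zp ->]; exists z => //; rewrite -ep in zp; have [_ _ _ zz] := k4 _ _ zp.
exact: around_key zz.
Qed.

Lemma keys_nbrs t v l : link_sound t v l -> uniq t ->
  uniq [seq pt t x | x <- unzip1 l] /\ {subset [seq pt t x | x <- unzip1 l] <= nbrs v}.
Proof.
move=> ls ut; split.
  rewrite map_inj_in_uniq; first exact: ls_keys ls.
  move=> x y /mapP[p pl ->] /mapP[q ql ->] /eqP.
  have [pk _ _ _] := link_bound ls ut pl; have [qk _ _ _] := link_bound ls ut ql.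
  by rewrite nth_uniq // => /eqP.
by move=> _ /mapP[_ /mapP[p pl ->] ->]; have [] := link_bound ls ut pl.
Qed.

(** The known neighbours are closed under passing to the next one, so they are all
neighbours by [nt_link]. *)
Lemma link_full t v l : link_sound t v l -> uniq t -> l != [::] ->
  all (fun p => eqn (size p.2) 2) l -> nbrs v = [set u in [seq pt t x | x <- unzip1 l]]%SET.
Proof.
move=> ls ut l0 l2; have [ku ks] := keys_nbrs ls ut.
apply/esym/(nt_link nt).
- by apply/fintype.subsetP => u; rewrite inE => /ks.
- case: l l0 ls ut l2 ku ks => [//|p l] _ _ _ _ _ _; apply/set0Pn; exists (pt t p.1).
  by rewrite !inE eqxx.
- move=> x; rewrite inE => /mapP[_ /mapP[p pl ->] ->].
  have [_ _ _ h] := link_bound ls ut pl; apply/fintype.subsetP => u ulk.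
  have [|y yl ->] := h _ u ulk; first by apply/eqnP; exact: (allP l2).
  by rewrite inE map_f.
Qed.

Lemma link_ok_sound t v l : link_sound t v l -> uniq t -> l != [::] -> link_ok (degree v) l.
Proof.
move=> ls ut l0; have [ku ks] := keys_nbrs ls ut; apply/and3P; split.
- have := uniq_leq_card ku ks; rewrite !size_map.
  by apply: leq_trans; rewrite /degree.
- by apply/allP => p pl; have [] := link_bound ls ut pl.
- apply/implyP => l2; apply/eqnP; have e := link_full ls ut l0 l2.
  rewrite /degree -/(nbrs v) e cardsE (card_uniqP ku) !size_map //.
Qed.

(** The corners of the quadrangle are known in every state; this is why the second face at
an edge with only one known face is always a triangle. *)
Record sound t s : Prop := Sound {
  so_uniq : uniq t;
  so_size1 : size s.1 = size t;
  so_size2 : size s.2 = size t;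
  so_degree : forall i, i < size t -> degree (pt t i) = degof s i;
  so_link : forall i, i < size t -> link_sound t (pt t i) (linkof s i);
  so_quad : [/\ 4 <= size t, pt t 0 = a, pt t 1 = b, pt t 2 = c & pt t 3 = d];
  so_corner : forall i x y, (i, x, y) \in quad_corners 0 1 2 3 -> y \in around x (linkof s i) }.

Lemma add_triangle_sound t s v w y : sound t s -> v < size t -> w < size t -> y < size t ->
  (forall i, i < size t -> i != y -> linkof s i != [::]) ->
  pt t y \in lk (pt t v) (pt t w) -> pt t y \in lk (pt t w) (pt t v) ->
  pt t w \in lk (pt t y) (pt t v) ->
  exists s', [/\ s' \in add_triangle s v w y, sound t s' &
    forall i, i < size t -> linkof s' i != [::]].
Proof.
move=> so vk wk yk ne r1 r2 r3; have [ut z1 z2 dg li qd co] := so.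
have neq i j k : i < size t -> j < size t -> pt t j \in lk k (pt t i) -> j != i.
  by move=> ik jk /(nt_adj nt)[_ _]; rewrite nth_uniq.
have yw : y != w := neq _ _ _ wk yk r1.
have yv : y != v := neq _ _ _ vk yk r2.
have wv : w != v := neq _ _ _ vk wk r3.
have [ay my ey] := add_corner_sound (li y yk) ut vk wk r3.
have [av mv ev] := add_corner_sound (li v vk) ut wk yk r1.
have [aw mw ew] := add_corner_sound (li w wk) ut vk yk r2.
have n0 x z l : z \in around x l -> l != [::] by case: l.
rewrite /add_triangle -!dg // (link_ok_sound ay ut (n0 _ _ _ my)) (link_ok_sound av ut (n0 _ _ _ mv)).
rewrite (link_ok_sound aw ut (n0 _ _ _ mw)).
set s' := (_, _); exists s'.
have lE i : linkof s' i = if i == y then add_corner v w (linkof s y) else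
    if i == w then add_corner v y (linkof s w) else
    if i == v then add_corner w y (linkof s v) else linkof s i.
  rewrite /linkof /s' /= nth_set_nth /= nth_set_nth /= nth_set_nth /=. reflexivity.
split; first by rewrite inE.
  split=> //.
  - by rewrite /s' /= !size_set_nth z2 !(maxn_idPr _).
  - move=> i ik; rewrite lE; have [->|_] := eqVneq i y; first by [].
    have [->|_] := eqVneq i w; first by [].
    by have [->|_] := eqVneq i v; [|exact: li].
  - move=> i x z h; rewrite lE; have := co _ _ _ h.
    have [->|_] := eqVneq i y; first exact: ey.
    have [->|_] := eqVneq i w; first exact: ew.
    by have [->|_] := eqVneq i v; [exact: ev|].
move=> i ik; rewrite lE; have [ei|niy] := eqVneq i y; first exact: n0 my.
have [_|_] := eqVneq i w; first exact: n0 mw.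
by have [_|_] := eqVneq i v; [exact: n0 mv|exact: ne].
Qed.

Lemma quad_corner_index t s v w Y : sound t s -> v < size t -> w < size t ->
  (pt t v, pt t w, Y) \in quad_corners a b c d ->
  exists2 y, (v, w, y) \in quad_corners 0 1 2 3 & Y = pt t y.
Proof.
move=> so vk wk; have [t4 e0 e1 e2 e3] := so_quad so.
have -> : quad_corners a b c d =
    [seq (pt t q.1.1, pt t q.1.2, pt t q.2) | q <- quad_corners 0 1 2 3].
  by rewrite /= e0 e1 e2 e3.
move=> /mapP[[[i j] l] q] /= [ev ew ->]; exists l => //.
have [i4 j4] : i < 4 /\ j < 4.
  by move: q; rewrite !inE => /or4P[|||/or4P[|||/orP[]]] /eqP[-> -> _].
have /eqP := ev; rewrite nth_uniq ?(so_uniq so) // ?(leq_trans i4) // => /eqP ->.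
by have /eqP := ew; rewrite nth_uniq ?(so_uniq so) // ?(leq_trans j4) // => /eqP ->.
Qed.

Lemma link_sound_rcons t v l Y : link_sound t v l -> link_sound (rcons t Y) v l.
Proof.
case=> k1 k2 k3 k4; split=> // x y /k4[h1 h2 h3 h4].
by rewrite size_rcons !nth_rcons h1 h2; split=> //; exact: leqW.
Qed.

Lemma add_vertex_sound t s Y : sound t s -> Y \notin t ->
  sound (rcons t Y) (add_vertex s (degree Y)) /\
  forall i, i < size t -> linkof (add_vertex s (degree Y)) i = linkof s i.
Proof.
move=> [ut z1 z2 dg li [t4 e0 e1 e2 e3] co] Yt.
have lE i : i < size t -> linkof (add_vertex s (degree Y)) i = linkof s i.
  by move=> ik; rewrite /linkof /= nth_rcons z2 ik.
have lk0 : linkof (add_vertex s (degree Y)) (size t) = [::].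
  by rewrite /linkof /= nth_rcons z2 ltnn eqxx.
split=> //; split.
- by rewrite rcons_uniq Yt.
- by rewrite /= !size_rcons z1.
- by rewrite /= !size_rcons z2.
- move=> i; rewrite size_rcons ltnS leq_eqVlt => /orP[/eqP->|ik].
    by rewrite nth_rcons ltnn eqxx /degof /= nth_rcons z1 ltnn eqxx.
  by rewrite nth_rcons ik dg // /degof /= nth_rcons z1 ik.
- move=> i; rewrite size_rcons ltnS leq_eqVlt => /orP[/eqP->|ik].
    by rewrite lk0; split.
  by rewrite nth_rcons ik lE //; apply: link_sound_rcons; exact: li.
- rewrite size_rcons !nth_rcons; have h n : n < 4 -> n < size t by move=> /leq_trans; apply.
  by rewrite !h // e0 e1 e2 e3; split=> //; exact: leqW.
- move=> i x y q; rewrite lE; first exact: co.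
  have : i < 4 by move: q; rewrite !inE => /or4P[|||/or4P[|||/orP[]]] /eqP[-> _ _].
  by move=> /leq_trans; apply.
Qed.

Lemma count_degree t s Y (n : nat) : sound t s -> Y \notin t -> degree Y = n ->
  count (eqn n) s.1 < #|[set v : G | degree v == n]%SET|.
Proof.
move=> so Yt dY; have es : s.1 = [seq degree u | u <- t].
  apply: (@eq_from_nth _ 0); first by rewrite size_map (so_size1 so).
  move=> i; rewrite (so_size1 so) => ik; rewrite (nth_map a) //.
  by rewrite (so_degree so).
rewrite es count_map -size_filter.
apply: (@uniq_leq_card _ (Y :: [seq u <- t | eqn n (degree u)])).
  by rewrite /= mem_filter (negbTE Yt) andbF filter_uniq // (so_uniq so).
move=> u; rewrite inE mem_filter inE => /orP[/eqP->|/andP[/eqnP -> _]] //.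
exact/eqP.
Qed.

(** The edge from [v] to [w] has a second face, with a third vertex [Y] at [v] different from
the known one.  It is not the quadrangle, whose corners are all known, so it is a
triangle. *)
Lemma children_sound t s v w : sound t s -> (forall i, i < size t -> linkof s i != [::]) ->
  v < size t -> size (around w (linkof s v)) = 1 ->
  exists t' s', [/\ s' \in children s v w, sound t' s' &
    forall i, i < size t' -> linkof s' i != [::]].
Proof.
move=> so full vk w1; have [x ex] : exists x, around w (linkof s v) = [:: x].
  by case: (around _ _) w1 => [|x []] // _; exists x.
have xw : x \in around w (linkof s v) by rewrite ex inE eqxx.
have [wk xk xlk _] := ls_real (so_link so vk) xw.
have [vw vx nxw] := nt_adj nt xlk.
have [Y Ylk Yx] : exists2 Y, Y \in lk (pt t v) (pt t w) & Y != pt t x.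
  have : 0 < #|lk (pt t v) (pt t w) :\ pt t x|%SET.
    by have := cardsD1 (pt t x) (lk (pt t v) (pt t w)); rewrite xlk (nt_card nt vw) => -[]; rewrite add0n => <-.
  by rewrite card_gt0 => /set0Pn[Y]; rewrite !inE => /andP[h1 h2]; exists Y.
have [[r2 r3]|] := nt_face nt Ylk; last first.
  move=> /(quad_corner_index so vk wk)[y /(so_corner so)]; rewrite ex inE => /eqP-> e.
  by rewrite e eqxx in Yx.
have [Yt|Yt] := boolP (Y \in t).
  have yk : index Y t < size t by rewrite index_mem.
  have eY : pt t (index Y t) = Y by rewrite nth_index.
  have [||||s' [h1 h2 h3]] := @add_triangle_sound t s v w (index Y t) so vk wk yk; rewrite ?eY //.
    by move=> i ik _; exact: full.
  exists t, s'; split=> //; rewrite /children mem_cat; apply/orP; left.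
  apply/flatten_mapP; exists (index Y t) => //.
  rewrite mem_filter mem_iota (so_size1 so) yk /= andbT ex /= orbF.
  have [_ vY nYw] := nt_adj nt Ylk.
  apply/and3P; split; apply/eqnP => e.
  - by move: (adj_neq vY); rewrite -e eY eqxx.
  - by move: nYw; rewrite -e eY eqxx.
  - by move: Yx; rewrite -e eY eqxx.
have [so' lE] := add_vertex_sound so Yt.
have vk' : v < size (rcons t Y) by rewrite size_rcons ltnW.
have wk' : w < size (rcons t Y) by rewrite size_rcons ltnW.
have yk' : size t < size (rcons t Y) by rewrite size_rcons.
have ev : pt (rcons t Y) v = pt t v by rewrite nth_rcons vk.
have ew : pt (rcons t Y) w = pt t w by rewrite nth_rcons wk.
have ey : pt (rcons t Y) (size t) = Y by rewrite nth_rcons ltnn eqxx.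
have [||||s' [h1 h2 h3]] := add_triangle_sound so' vk' wk' yk'; rewrite ?ev ?ew ?ey //.
  move=> i; rewrite size_rcons ltnS leq_eqVlt => /orP[/eqP->|ik _]; first by rewrite eqxx.
  by rewrite lE // full.
exists (rcons t Y), s'; split=> //; rewrite /children mem_cat mem_cat (so_size1 so).
apply/orP; right; apply/orP.
have [d5|d7] := degrees Y.
  by left; have := count_degree so Yt d5; rewrite degree5 => ->; rewrite -d5.
by right; have := count_degree so Yt d7; rewrite degree7 => ->; rewrite -d7.
Qed.

(** A state without open edges is closed under adjacency, so it contains all 20 vertices
because the graph is connected. *)
Lemma refuted_sound fuel t s : refuted fuel s -> sound t s ->
  (forall i, i < size t -> linkof s i != [::]) -> False.
Proof.
elim: fuel t s => [//|n IH] t s /=.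
case: (pick_side s.1 s.2 0 None) => [[[sc v] w]|].
  move=> /and3P[vk /eqnP w1 /allP ch] so full; rewrite (so_size1 so) in vk.
  have [t' [s' [h1 h2 h3]]] := children_sound so full vk w1.
  exact: IH (ch _ h1) h2 h3.
move=> /andP[/allP closed small] so full; rewrite (so_size1 so) in small.
have [t4 _ _ _ _] := so_quad so.
pose S := [set u in t]%SET.
have SE : forall u, u \in S.
  apply: connected; first by apply/set0Pn; exists (pt t 0); rewrite inE mem_nth // (leq_trans _ t4).
  move=> x y; rewrite !inE => xt xy; have xk : index x t < size t by rewrite index_mem.
  have ls := so_link so xk; rewrite nth_index // in ls.
  have lin : linkof s (index x t) \in s.2 by apply: mem_nth; rewrite (so_size2 so).
  have e := link_full ls (so_uniq so) (full _ xk) (closed _ lin).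
  have : y \in nbrs x by rewrite inE.
  rewrite e inE => /mapP[_ /mapP[p pl ->] ->].
  by have [pk _ _ _] := link_bound ls (so_uniq so) pl; exact: mem_nth.
move: small; rewrite -(card_uniqP (so_uniq so)) ltnNge -cardG; case/negP.
by apply: subset_leq_card; apply/fintype.subsetP => u _; have := SE u; rewrite inE.
Qed.

Lemma start_sound : sound [:: a; b; c; d] (start (degree a) (degree b) (degree c) (degree d)).
Proof.
have [u q] := nt_quad nt; split=> //.
- by case=> [|[|[|[|i]]]].
- have qE v x y : (v, x, y) \in quad_corners a b c d -> y \in lk v x := q v x y.
  have two (v : G) i j : i < 4 -> j < 4 ->
      pt [:: a; b; c; d] i \in lk v (pt [:: a; b; c; d] j) ->
      link_sound [:: a; b; c; d] v (add_corner j i [::]).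
    have nil : link_sound [:: a; b; c; d] v [::] by split.
    by move=> i4 j4 h; have [] := add_corner_sound nil u j4 i4 h.
  case=> [|[|[|[|i]]]] //= _; [apply: (two _ 1 3)|apply: (two _ 0 2)|apply: (two _ 1 3)|
    apply: (two _ 0 2)] => //=; apply: qE; by rewrite /quad_corners !inE !eqxx ?orbT.
- by move=> i x y; rewrite !inE => /or4P[|||/or4P[|||/orP[]]] /eqP[-> -> ->].
Qed.

Lemma start_refuted d0 d1 d2 d3 : degree a = d0 -> degree b = d1 -> degree c = d2 ->
  degree d = d3 -> refuted 100 (start d0 d1 d2 d3) -> False.
Proof.
move=> <- <- <- <- r; apply: (refuted_sound r start_sound).
by case=> [|[|[|[|i]]]].
Qed.
End Search.

Lemma quad_corners_rot (T : eqType) (a b c d : T) : quad_corners b c d a =i quad_corners a b c d.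
Proof. by move=> t; rewrite !inE; do 8! [case: (t == _)]. Qed.

Lemma near_triangulation_rot (G : sgraph) (lk : G -> G -> {set G}) a b c d :
  near_triangulation lk a b c d -> near_triangulation lk b c d a.
Proof.
case=> h1 h2 h3 h4 [h5 h6] h7; split=> //.
- by move=> v x y; rewrite quad_corners_rot; exact: h4.
- split; first by rewrite -[[:: b; c; d; a]]/(rot 1 [:: a; b; c; d]) rot_uniq.
  by move=> v x y; rewrite quad_corners_rot; exact: h6.
Qed.

Lemma no_near_triangulation (G : sgraph) (lk : G -> G -> {set G}) a b c d :
  near_triangulation lk a b c d -> #|G| = 20 ->
  (forall v : G, degree v = 5 \/ degree v = 7) ->
  #|[set v : G | degree v == 5]%SET| = 17 -> #|[set v : G | degree v == 7]%SET| = 3 ->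
  (forall S : {set G}, S != finset.set0 ->
    (forall x y, x \in S -> adj x y -> y \in S) -> forall x, x \in S) ->
  all_refuted -> False.
Proof.
rewrite /all_refuted => nt cardG dg d5 d7 con /and5P[r0 r1 r2 r3 r4].
have nt1 := near_triangulation_rot nt; have nt2 := near_triangulation_rot nt1.
have nt3 := near_triangulation_rot nt2.
have no x y z w (ntx : near_triangulation lk x y z w) := start_refuted ntx cardG dg d5 d7 con.
case: (dg a) (dg b) (dg c) (dg d) => ea [] eb [] ec [] ed.
- exact: (no _ _ _ _ nt _ _ _ _ ea eb ec ed r0).
- exact: (no _ _ _ _ nt _ _ _ _ ea eb ec ed r1).
- exact: (no _ _ _ _ nt3 _ _ _ _ ed ea eb ec r1).
- exact: (no _ _ _ _ nt _ _ _ _ ea eb ec ed r2).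
- exact: (no _ _ _ _ nt2 _ _ _ _ ec ed ea eb r1).
- exact: (no _ _ _ _ nt _ _ _ _ ea eb ec ed r3).
- exact: (no _ _ _ _ nt3 _ _ _ _ ed ea eb ec r2).
- exact: (no _ _ _ _ nt _ _ _ _ ea eb ec ed r4).
- exact: (no _ _ _ _ nt1 _ _ _ _ eb ec ed ea r1).
- exact: (no _ _ _ _ nt1 _ _ _ _ eb ec ed ea r2).
- exact: (no _ _ _ _ nt1 _ _ _ _ eb ec ed ea r3).
- exact: (no _ _ _ _ nt1 _ _ _ _ eb ec ed ea r4).
- exact: (no _ _ _ _ nt2 _ _ _ _ ec ed ea eb r2).
- exact: (no _ _ _ _ nt2 _ _ _ _ ec ed ea eb r4).
- exact: (no _ _ _ _ nt3 _ _ _ _ ed ea eb ec r4).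
(* otherwise closing tactics would evaluate the search *)
clear r0 r1 r2 r3 r4; have [u _] := nt_quad nt.
suff : 4 <= #|[set v : G | degree v == 7]%SET| by rewrite d7.
apply: (@uniq_leq_card _ [:: a; b; c; d]) => // v.
by rewrite !inE => /or4P[] /eqP->; rewrite ?ea ?eb ?ec ?ed.
Qed.

(** * The theorem *)

Section DegreeSequence.
Variables (G : sgraph) (ds : seq nat).
Hypothesis dsG : degree_sequence G = ds.

Lemma degree_perm : perm_eq [seq degree x | x <- enum G] ds.
Proof. by rewrite -dsG /degree_sequence perm_sym perm_sort. Qed.

Lemma degree_sequence_card : #|G| = size ds.
Proof. by rewrite -(perm_size degree_perm) size_map cardE. Qed.

Lemma degree_sequence_mem (v : G) : degree v \in ds.
Proof. by rewrite -(perm_mem degree_perm) map_f // mem_enum. Qed.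

Lemma degree_sequence_count n : #|[set v : G | degree v == n]%SET| = count_mem n ds.
Proof.
rewrite -(permP degree_perm) count_map -size_filter cardE /enum_mem -enumT.
by rewrite /= -filter_predI; congr size; apply: eq_filter => v /=; rewrite !inE andbT.
Qed.

Lemma degree_sequence_edges : sumn ds = 2 * #|edges G|.
Proof.
rewrite -sum_degree -(perm_sumn degree_perm) sumnE big_map big_enum.
by [].
Qed.
End DegreeSequence.

Lemma all_refuted_true : all_refuted.
Proof. vm_cast_no_check (erefl true). Qed.

Theorem mainTheorem2 (R : realType) :
  ~ planar_graphical R (nseq 3 7 ++ nseq 17 5).
Proof.
move=> [G [[pos [arc emb]] dsG]].
have [C [b [N gm]]] := planar_grid_minor emb.
have [F [face tb]] := grid_minor_two_basis gm.
have cardG : #|G| = 20 := degree_sequence_card dsG.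
have cardE : #|edges G| = 53 by have := degree_sequence_edges dsG; rewrite /=; lia.
have degrees (v : G) : degree v = 5 \/ degree v = 7.
  have := degree_sequence_mem dsG v; rewrite mem_cat !mem_nseq /= => /orP[]/eqP; auto.
have min_degree (v : G) : 5 <= degree v by case: (degrees v) => ->.
have [a [b' [c [d nt]]]] := dense_near_triangulation gm tb cardG cardE min_degree.
apply: (no_near_triangulation nt cardG degrees _ _ _ all_refuted_true).
- by rewrite (degree_sequence_count dsG).
- by rewrite (degree_sequence_count dsG).
- exact: (dense_connected gm cardG cardE min_degree).
Qed.
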